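(* Let $C$ be a smooth real curve of even degree $d$ in $\mathbb{P}^2$. Up to closure, the avoidance locus $\mathcal{A}_C$ is a union of connected components of $(\mathbb{P}^2)^\vee_{\mathbb{R}}\setminus C^\vee_{\mathbb{R}}$. Each component appearing in $\mathcal{A}_C$ is convex, when regarded as a cone in $\mathbb{R}^3$.
   Context: The avoidance locus $\mathcal{A}_C$ is the set of all lines in $\mathbb{P}^2_{\mathbb{R}}$ that do not intersect the real curve $C_{\mathbb{R}}$ (the set of real points of $C$); it is a semi-algebraic subset of the dual real projective plane $(\mathbb{P}^2)^\vee_{\mathbb{R}}$, in which the point $(u:v:w)$ represents the line $ux+vy+wz=0$. The dual curve $C^\vee\subset(\mathbb{P}^2)^\vee$ is the curve of degree $d(d-1)$ whose points correspond to the lines in $\mathbb{P}^2$ that are tangent to $C$, and $C^\vee_{\mathbb{R}}$ is its set of real points. The prefix ''up to closure'' refers to the fact that $\mathcal{A}_C$ also contains some points of $C^\vee_{\mathbb{R}}$, corresponding to real lines that do not meet $C_{\mathbb{R}}$ but are tangent to $C$ at complex (non-real) points; the set $\mathcal{A}_C\setminus C^\vee_{\mathbb{R}}$ is the union of connected components in question.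
   Formalization: Convexity is stated for each component U together with the points of the dual curve that lie in the avoidance locus and in the closure of U; U alone is not convex if such a point punctures it, e.g. the line z=0 for (x²+y²)²+x³z−z⁴. *)

(* Defs.v *)
From HB Require Import structures.
(* The notations of mpoly clash with those of mathcomp-analysis. *)
From mathcomp Require Import -(notations) mpoly complex.
From mathcomp Require Import all_boot all_order all_algebra.
From mathcomp Require Import generic_quotient.
From mathcomp Require Import all_classical all_reals all_analysis.

Set Implicit Arguments.
Unset Strict Implicit.
Unset Printing Implicit Defensive.

Import Order.TTheory GRing.Theory Num.Theory.
Import numFieldNormedType.Exports.

Local Open Scope classical_set_scope.
Local Open Scope ring_scope.
Local Open Scope quotient_scope.

Definition tpoly (K : comNzRingType) := mpoly 3 K.

Definition is_form (K : comNzRingType) (d : nat) (f : tpoly K) : bool :=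
  f \is ishomog1 d mdeg.

Definition evalf (K : comNzRingType) (f : tpoly K) (v : 'rV[K]_3) : K :=
  meval (fun i => v 0 i) f.

Definition gradient (K : comNzRingType) (f : tpoly K) (v : 'rV[K]_3) : 'rV[K]_3 :=
  \row_i evalf (mderiv i f) v.

Definition complexify (R : realType) (f : tpoly R) : tpoly (complex R) :=
  map_mpoly (@real_complex R) f.

(* The plane curve f = 0 is smooth as a complex curve, i.e. also at its
   non-real points. *)
Definition smooth_curve (R : realType) (f : tpoly R) : Prop :=
  forall p : 'rV[complex R]_3, p != 0 ->
    evalf (complexify f) p = 0 -> gradient (complexify f) p != 0.

Section RealProjectivePlane.
Variable R : realType.

Definition nzvec := set_type [set v : 'rV[R]_3 | v != 0].

Definition proportional (v w : nzvec) : bool :=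
  `[< exists2 c : R, c != 0 & val w = c *: val v >].

Lemma proportional_refl : reflexive proportional.
Proof. by move=> v; apply/asboolP; exists 1; rewrite ?oner_neq0 ?scale1r. Qed.

Lemma proportional_sym : symmetric proportional.
Proof.
suff H v w : proportional v w -> proportional w v by move=> v w; apply/idP/idP; exact: H.
move=> /asboolP[c c0 e]; apply/asboolP; exists c^-1; first by rewrite invr_eq0.
by rewrite e scalerA mulVf ?scale1r.
Qed.

Lemma proportional_trans : transitive proportional.
Proof.
move=> w v u /asboolP[c c0 e] /asboolP[c' c'0 e']; apply/asboolP.
by exists (c' * c); rewrite ?mulf_neq0// e' e scalerA.
Qed.

Canonical proportional_equiv :=
  EquivRel proportional proportional_refl proportional_sym proportional_trans.

(* P^2(R) with the quotient topology of R^3 \ {0}.  The same type serves for the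
   dual plane: its point (u : v : w) is the line u x + v y + w z = 0. *)
Definition RP2 : Type := quotient_topology {eq_quot proportional_equiv}.

HB.instance Definition _ := Topological.on RP2.
HB.instance Definition _ := Quotient.on RP2.

(* Homogeneous coordinates of x, for the representative chosen by repr; for a form f
   nothing below depends on this choice. *)
Definition hcoord (x : RP2) : 'rV[R]_3 := val (repr x).

Definition on_line (l x : RP2) : Prop :=
  \sum_i hcoord l 0 i * hcoord x 0 i = 0.

Variable f : tpoly R.

Definition real_points : set RP2 := [set x | evalf f (hcoord x) = 0].

Definition avoidance_locus : set RP2 :=
  [set l | forall x, real_points x -> ~ on_line l x].

(* The real line l is the tangent line of the complex curve f = 0 at its point
   p: the coordinate vector of l is proportional to the gradient of f at p. *)
Definition tangent_at (l : RP2) (p : 'rV[complex R]_3) : Prop :=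
  evalf (complexify f) p = 0 /\
  exists c : complex R,
    map_mx (@real_complex R) (hcoord l) = c *: gradient (complexify f) p.

Definition real_dual_curve : set RP2 :=
  [set l | exists2 p : 'rV[complex R]_3, p != 0 & tangent_at l p].

End RealProjectivePlane.

Definition components (T : topologicalType) (A : set T) : set (set T) :=
  [set connected_component A x | x in A].

(* A real line that misses the real points of the curve but is tangent to it at two
   conjugate points is a point of the dual curve lying inside the avoidance locus,
   so it punctures the component U of the complement of the dual curve around it.
   The corresponding piece of the avoidance locus is U with these points put back. *)
Definition filled_component (R : realType) (f : tpoly R) (U : set (RP2 R)) :
  set (RP2 R) := closure U `&` avoidance_locus f.

(* Nonzero vectors of the cone over S in R^3; it is stable under v |-> - v. *)
Definition punctured_cone (R : realType) (S : set (RP2 R)) : set 'rV[R]_3 :=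
  [set val v | v in [set v : nzvec R | S (\pi_(RP2 R) v)]].

(* A punctured cone is symmetric about 0, so a projectively convex proper S gives
   two opposite convex cones; hence convexity is asked of each connected component,
   completed by the apex. *)
Definition convex_as_cone (R : realType) (S : set (RP2 R)) : Prop :=
  forall K, components (punctured_cone S) K -> convex_set (0 |` K).

(* Main.v *)
(** A real form f of even degree vanishes nowhere on an avoiding line, so f has
    a sign there, whereas on a line that meets the real curve and is not tangent
    to it f takes both signs.  Both conditions are open, so off the dual curve the
    avoidance locus is open and closed.

    The dual curve may enter the avoidance locus, through the real lines tangent
    to the curve at two conjugate points.  It does not separate it, even locally.
    For two such lines l, l' tangent at nearby points p, p' the trapezoid rule for
    f on the segment [p, p'] gives (l' - l).(p + p') = O(|p' - p|^3); as l' - l is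
    real and p is not, l' - l = O(|p' - p|^3).  The points p form a
    subset of a complex curve, of real dimension 2, so by pigeonhole the
    coordinates of these lines cannot fill an interval.  Hence near an avoiding line
    there are horizontal and vertical segments of non-tangent lines as close as
    desired to any given ones, and they connect the complement of the dual curve.

    So closing up a component inside the avoidance locus gives a whole component of
    that locus.  The cone over it is cut out by fixing the sign of v.x for
    each real point x of the curve (this is a pair of opposite convex cones), and
    it is everything when the curve has no real point. *)

Require Import Defs.
From mathcomp Require Import -(notations) mpoly complex.
From mathcomp Require Import all_boot all_order all_algebra.
From mathcomp Require Import generic_quotient.
From mathcomp Require Import all_classical all_reals all_analysis.
From mathcomp Require Import ring lra zify.

Set Implicit Arguments.
Unset Strict Implicit.
Unset Printing Implicit Defensive.

Import Order.TTheory GRing.Theory Num.Theory.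
Import numFieldNormedType.Exports.

Local Open Scope classical_set_scope.
Local Open Scope ring_scope.
Local Open Scope quotient_scope.
Import Normc.

(** * Polynomials on lines *)

(** Evaluation, restriction to a line and differentiation are all determined by constants,
    variables, sums and products; this induction spares sums over monomials. *)
Lemma mpoly_alg_ind (n : nat) (K : comNzRingType) (P : mpoly n K -> Prop) :
  (forall c, P (mpolyC n c)) -> (forall i, P (mpolyX K (mnm1 i))) ->
  (forall p q, P p -> P q -> P (p + q)) ->
  (forall p q, P p -> P q -> P (p * q)) -> forall p, P p.
Proof.
move=> PC PX PD PM.
have P0 : P 0 by rewrite -(mpolyC0 n K).
have P1 : P 1 by rewrite -(mpolyC1 n K).
elim/mpolyind=> // c m p _ _ Pp; apply: (PD) => //.
rewrite -mul_mpolyC; apply: (PM) => //; rewrite mpolyXE_id.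
elim/big_ind: _ => // i _.
by elim: (m i) => [|k IH]; rewrite ?expr0// exprS; apply: (PM).
Qed.

(** The coefficient morphism [phi] makes one statement cover both the scaling of vectors over [K]
    and the substitution of elements of [{poly K}], as in [line_poly]. *)
Lemma meval_homog (n d : nat) (K L : comNzRingType) (phi : {rmorphism K -> L})
    (f : mpoly n K) (a : L) (w : 'I_n -> L) : f \is ishomog1 d mdeg ->
  meval (fun i => a * w i) (map_mpoly phi f) = a ^+ d * meval w (map_mpoly phi f).
Proof.
move=> /dhomogP fd; rewrite !mevalE mulr_sumr; apply: eq_big_seq => m.
rewrite (mcoeff_msupp (map_mpoly phi f) m) mcoeff_map_mpoly => fm0.

rewrite (eq_bigr (fun i => a ^+ m i * w i ^+ m i)) => [|i _]; last first.
  by rewrite exprMn.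
rewrite big_split /= prodrXr mulrCA; congr (a ^+ _ * _).
suff <- : mdeg m = d by rewrite mdegE.
apply: fd; rewrite (mcoeff_msupp f m).
by apply: contra fm0 => /eqP ->; apply/eqP; exact: rmorph0.
Qed.

Lemma evalf_homog (d : nat) (K : comNzRingType) (f : tpoly K) a (v : 'rV[K]_3) :
  is_form d f -> evalf f (a *: v) = a ^+ d * evalf f v.
Proof.
move=> fd; have /= := meval_homog idfun a (fun i => v 0 i) fd.
have -> : map_mpoly idfun f = f.
  by apply/mpolyP => m; rewrite mcoeff_map_mpoly.
by move=> <-; apply: meval_eq => i; rewrite mxE.
Qed.

(** Restricting to a line turns Taylor estimates for forms into estimates on the coefficients of a
    polynomial in one variable. *)
Definition line_poly (K : comNzRingType) (f : tpoly K) (v m : 'rV[K]_3) : {poly K} :=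
  meval (fun i => (v 0 i)%:P + m 0 i *: 'X) (map_mpoly (@polyC K) f).

Section LinePoly.
Variables (K : comNzRingType) (v m : 'rV[K]_3).
Implicit Types f g : tpoly K.

Lemma line_polyC c : line_poly (mpolyC 3 c) v m = c%:P.
Proof. by rewrite /line_poly map_mpolyC mevalC. Qed.

Lemma line_polyX i : line_poly (mpolyX K (mnm1 i)) v m = (v 0 i)%:P + m 0 i *: 'X.
Proof. by rewrite /line_poly map_mpolyX mevalXU. Qed.

Lemma line_polyD f g : line_poly (f + g) v m = line_poly f v m + line_poly g v m.
Proof. by rewrite /line_poly rmorphD mevalD. Qed.

Lemma line_polyM f g : line_poly (f * g) v m = line_poly f v m * line_poly g v m.
Proof. by rewrite /line_poly rmorphM mevalM. Qed.

Lemma line_poly_diag d f : is_form d f ->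
  line_poly f v v = (1 + 'X) ^+ d * (evalf f v)%:P.
Proof.
move=> fd.
rewrite /line_poly (@meval_eq _ _ _ (fun i => (1 + 'X) * (v 0 i)%:P)) => [|i].
  rewrite (meval_homog _ _ _ fd); congr (_ * _); rewrite /evalf.
  elim/mpoly_alg_ind: (f) => [a|i|p q Hp Hq|p q Hp Hq].
  + by rewrite map_mpolyC !mevalC.
  + by rewrite map_mpolyX !mevalXU.
  + by rewrite rmorphD !mevalD polyCD; exact: (f_equal2 +%R Hp Hq).
  + by rewrite rmorphM !mevalM polyCM; exact: (f_equal2 *%R Hp Hq).
by rewrite mulrDl mul1r -mul_polyC [in RHS]mulrC.
Qed.

Opaque line_poly.

Lemma horner_line_poly f c : (line_poly f v m).[c] = evalf f (v + c *: m).
Proof.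
rewrite /evalf; elim/mpoly_alg_ind: f => [a|i|p q Hp Hq|p q Hp Hq].
- by rewrite line_polyC mevalC hornerC.
- by rewrite line_polyX mevalXU !mxE hornerD hornerC hornerZ hornerX mulrC.
- rewrite line_polyD mevalD hornerD; exact: (f_equal2 +%R Hp Hq).
- rewrite line_polyM mevalM hornerM; exact: (f_equal2 *%R Hp Hq).
Qed.

(** The chain rule: both sides are derivations in [f] over the evaluation, so agreement on constants
    and variables suffices. *)
Lemma deriv_line_poly f :
  (line_poly f v m)^`() = \sum_i m 0 i *: line_poly (mderiv i f) v m.
Proof.
elim/mpoly_alg_ind: f => [a|i|p q Hp Hq|p q Hp Hq].
- rewrite line_polyC derivC big1// => i _.
  by rewrite mderivC -(mpolyC0 3 K) line_polyC scaler0.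
- rewrite line_polyX derivD derivC derivZ derivX add0r (bigD1 i)//= big1 => [|j ji].
    rewrite mderivX mnmE eqxx mulr1n scale1r.
    have -> : mnm_sub (mnm1 i) (mnm1 i) = mnm0.
      by apply/mnmP => k; rewrite mnmBE mnmE subnn mnmE.
    by rewrite mpolyX0 -(mpolyC1 3 K) line_polyC addr0.
  by rewrite mderivX mnmE eq_sym (negPf ji) scale0r -(mpolyC0 3 K) line_polyC scaler0.
- rewrite line_polyD derivD (f_equal2 +%R Hp Hq) -big_split; apply: eq_bigr => i _ /=.
  by rewrite mderivD line_polyD scalerDr.
- rewrite line_polyM derivM.
  rewrite (f_equal2 (fun x y => x * line_poly q v m + line_poly p v m * y) Hp Hq).
  rewrite mulr_suml mulr_sumr -big_split.
  apply: eq_bigr => i _ /=.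
  rewrite mderivM line_polyD scalerDr -scalerAl -scalerAr.
  by rewrite (line_polyM (mderiv i p) q) (line_polyM p (mderiv i q)).
Qed.

Lemma horner_deriv_line_poly f c :
  (line_poly f v m)^`().[c] = \sum_i m 0 i * gradient f (v + c *: m) 0 i.
Proof.
rewrite deriv_line_poly horner_sum; apply: eq_bigr => i _.
by rewrite hornerZ horner_line_poly mxE.
Qed.

End LinePoly.

(** Euler's relation, by differentiating f((1 + X) v) = (1 + X)^d f(v) at X = 0. *)
Lemma euler_form (d : nat) (K : comNzRingType) (f : tpoly K) (v : 'rV[K]_3) :
  is_form d f -> \sum_i v 0 i * gradient f v 0 i = evalf f v *+ d.
Proof.
move=> fd; have := horner_deriv_line_poly v v f 0.
rewrite scale0r addr0 (line_poly_diag _ fd) => <-.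
rewrite derivM derivC mulr0 addr0 deriv_exp derivD derivX derivC add0r mul1r.
rewrite hornerM hornerC hornerMn horner_exp hornerD hornerC hornerX addr0.
by rewrite expr1n mulrnAl mul1r.
Qed.

Lemma mderiv_homog (d : nat) (K : comNzRingType) (f : tpoly K) i :
  is_form d f -> is_form d.-1 (mderiv i f).
Proof.
move=> /dhomogP fd; apply/dhomogP => m.
rewrite (mcoeff_msupp (mderiv i f) m) mcoeff_mderiv => fm.
suff dE : mdeg (mnm_add m (mnm1 i)) = d.
  by rewrite -dE mdegD mdeg1 addn1.
apply: fd; rewrite (mcoeff_msupp f (mnm_add m (mnm1 i))).
by apply: contra fm => /eqP ->; rewrite mul0rn.
Qed.

Lemma gradient_homog (d : nat) (K : comNzRingType) (f : tpoly K) a (v : 'rV[K]_3) :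
  is_form d f -> gradient f (a *: v) = a ^+ d.-1 *: gradient f v.
Proof.
by move=> fd; apply/rowP => i; rewrite !mxE (evalf_homog _ _ (mderiv_homog i fd)).
Qed.

Lemma complexify_homog (R : realType) (d : nat) (f : tpoly R) :
  is_form d f -> is_form d (complexify f).
Proof.
move=> /dhomogP fd; apply/dhomogP => m.
rewrite (mcoeff_msupp (complexify f) m) mcoeff_map_mpoly => fm.
apply: fd; rewrite (mcoeff_msupp f m).
by apply: contra fm => /eqP ->; apply/eqP; exact: rmorph0.
Qed.

Lemma evalf_complexify (R : realType) (f : tpoly R) v :
  evalf (complexify f) (map_mx (@real_complex R) v) = real_complex R (evalf f v).
Proof.
rewrite /evalf /complexify; elim/mpoly_alg_ind: f => [a|i|p q Hp Hq|p q Hp Hq].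
- by rewrite map_mpolyC !mevalC.
- by rewrite map_mpolyX !mevalXU mxE.
- rewrite rmorphD !mevalD rmorphD; exact: (f_equal2 +%R Hp Hq).
- rewrite rmorphM !mevalM rmorphM; exact: (f_equal2 *%R Hp Hq).
Qed.

Lemma mderiv_complexify (R : realType) (f : tpoly R) i :
  mderiv i (complexify f) = complexify (mderiv i f).
Proof.
apply/mpolyP => m; rewrite mcoeff_mderiv !mcoeff_map_mpoly mcoeff_mderiv.
by rewrite [in RHS]raddfMn.
Qed.

Lemma gradient_complexify (R : realType) (f : tpoly R) v :
  gradient (complexify f) (map_mx (@real_complex R) v)
  = map_mx (@real_complex R) (gradient f v).
Proof.
by apply/rowP => i; rewrite !mxE mderiv_complexify evalf_complexify.
Qed.

(** * Complex Taylor estimates *)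

Section NormcTheory.
Variable R : realType.
Local Notation C := (complex R).
Local Notation rc := (real_complex R).

Lemma normcD (x y : C) : normc (x + y) <= normc x + normc y.
Proof. exact: le_normcD. Qed.

Lemma normc_opp (x : C) : normc (- x) = normc x.
Proof. exact: normcN. Qed.

Lemma normcB (x y : C) : normc (x - y) <= normc x + normc y.
Proof. by rewrite -(normc_opp y) normcD. Qed.

Lemma normc_ge0 (x : C) : 0 <= normc x.
Proof. by case: x => a b; rewrite sqrtr_ge0. Qed.

Lemma normc_sqr (x : C) : normc x ^+ 2 = complex.Re x ^+ 2 + complex.Im x ^+ 2.
Proof. by case: x => a b; rewrite sqr_sqrtr// addr_ge0// sqr_ge0. Qed.

Lemma normc_real (a : R) : normc (rc a) = `|a|.
Proof. by rewrite /= expr0n/= addr0 sqrtr_sqr. Qed.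

Lemma normc_Re (x : C) : `|complex.Re x| <= normc x.
Proof.
by case: x => a b /=; rewrite -sqrtr_sqr ler_wsqrtr// lerDl sqr_ge0.
Qed.

Lemma normc_Im (x : C) : `|complex.Im x| <= normc x.
Proof.
by case: x => a b /=; rewrite -sqrtr_sqr ler_wsqrtr// lerDr sqr_ge0.
Qed.

Lemma normc_le_ReIm (x : C) : normc x <= `|complex.Re x| + `|complex.Im x|.
Proof.
rewrite -(@ler_pXn2r _ 2)// ?nnegrE ?normc_ge0 ?addr_ge0//.
rewrite normc_sqr sqrrD !real_normK ?num_real// -addrA [_ *+ 2 + _]addrC addrA lerDl.
by rewrite mulrn_wge0// mulr_ge0.
Qed.

Lemma normcX (x : C) n : normc (x ^+ n) = normc x ^+ n.
Proof. by elim: n => [|n IH]; rewrite ?expr0 ?normc1// !exprS normcM IH. Qed.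

Lemma normc_sum (I : Type) (r : seq I) (P : pred I) (F : I -> C) :
  normc (\sum_(i <- r | P i) F i) <= \sum_(i <- r | P i) normc (F i).
Proof.
elim/big_rec2: _ => [|i y x _ IH]; first by rewrite normc0.
by apply: le_trans (normcD _ _) _; rewrite lerD2l.
Qed.

Lemma Re_add (x y : C) : complex.Re (x + y) = complex.Re x + complex.Re y.
Proof. by case: x; case: y. Qed.

Lemma Im_add (x y : C) : complex.Im (x + y) = complex.Im x + complex.Im y.
Proof. by case: x; case: y. Qed.

Lemma Re_mul (x y : C) : complex.Re (x * y) =
  complex.Re x * complex.Re y - complex.Im x * complex.Im y.
Proof. by case: x; case: y. Qed.

Lemma Im_mul (x y : C) : complex.Im (x * y) =
  complex.Re x * complex.Im y + complex.Im x * complex.Re y.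
Proof. by case: x; case: y. Qed.

Lemma complex_eqP (x y : C) :
  complex.Re x = complex.Re y -> complex.Im x = complex.Im y -> x = y.
Proof. by case: x => a b; case: y => a' b' /= -> ->. Qed.

Lemma complex_eta (x : C) : x = Complex (complex.Re x) (complex.Im x).
Proof. by case: x. Qed.

End NormcTheory.

Section Taylor.
Variable R : realType.
Local Notation C := (complex R).
Local Notation rc := (real_complex R).

(** The bounds are uniform over base points and directions in a box, so that the Taylor constants do
    not depend on the pair of tangency points. *)
Lemma line_poly_bound (f : tpoly C) (B : R) : exists n (M : R), 0 <= M /\
  forall v m : 'rV[C]_3, (forall i, normc (v 0 i) <= B) ->
    (forall i, normc (m 0 i) <= B) ->
  (size (line_poly f v m) <= n)%N /\ forall k, normc (line_poly f v m)`_k <= M.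
Proof.
elim/mpoly_alg_ind: f => [a|i|p q [n1 [M1 [M10 H1]]] [n2 [M2 [M20 H2]]]
  |p q [n1 [M1 [M10 H1]]] [n2 [M2 [M20 H2]]]].
- exists 1%N, (normc a); split => [|v m _ _]; first exact: normc_ge0.
  rewrite line_polyC size_polyC; split => [|k]; first by case: eqP.
  by rewrite coefC; case: ifP => // _; rewrite normc0 normc_ge0.
- exists 2%N, `|B|; split => // v m Hv Hm; rewrite line_polyX; split.
    apply: leq_trans (size_polyD _ _) _; rewrite geq_max size_polyC.
    apply/andP; split; first by case: eqP.
    by apply: leq_trans (size_scale_leq _ _) _; rewrite size_polyX.
  move=> k; rewrite coefD coefC coefZ coefX.
  case: k => [|[|k]] /=; rewrite ?mulr0 ?addr0 ?add0r ?mulr1 ?normc0//.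
    exact: le_trans (Hv _) (ler_norm _).
  exact: le_trans (Hm _) (ler_norm _).
- exists (maxn n1 n2), (M1 + M2); split => [|v m Hv Hm]; first exact: addr_ge0.
  have [s1 b1] := H1 v m Hv Hm; have [s2 b2] := H2 v m Hv Hm.
  rewrite line_polyD; split.
    apply: leq_trans (size_polyD _ _) _.
    rewrite geq_max; apply/andP; split.
      exact: leq_trans s1 (leq_maxl _ _).
    exact: leq_trans s2 (leq_maxr _ _).
  move=> k.
  have := b1 k; have := b2 k; rewrite coefD => h1 h2.
  apply: le_trans (normcD _ _) _.
  exact: lerD.
(* Coefficient [k] of the product has [k + 1] terms, at most [n1 + n2] of them when [k] is within
   the size bound. *)
- exists (n1 + n2)%N, ((n1 + n2)%N%:R * (M1 * M2)).
  split => [|v m Hv Hm]; first by rewrite !mulr_ge0.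
  have [s1 b1] := H1 v m Hv Hm; have [s2 b2] := H2 v m Hv Hm.
  rewrite line_polyM.
  have sz : (size (line_poly p v m * line_poly q v m)%R <= n1 + n2)%N.
    apply: leq_trans (size_polyMleq _ _) _.
    by apply: leq_trans (leq_pred _) _; apply: leq_add.
  split => // k; have [kn|nk] := ltnP k (n1 + n2); last first.
    by rewrite nth_default ?normc0 ?mulr_ge0//; exact: leq_trans sz nk.
  rewrite coefM; apply: le_trans (normc_sum _ _ _) _.
  apply: (@le_trans _ _ (\sum_(j < k.+1) (M1 * M2))).
    apply: ler_sum => j _; rewrite normcM.
    by apply: ler_pM; [exact: normc_ge0 | exact: normc_ge0 | exact: b1 | exact: b2].
  by rewrite sumr_const card_ord mulr_natl ler_wpMn2l// mulr_ge0.
Qed.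

Section OnePoly.
Variables (Q : {poly C}) (n : nat) (M : R) (a : C).
Hypotheses (sQ : (size Q <= n)%N) (bQ : forall k, normc Q`_k <= M).
Hypothesis a1 : normc a <= 1.

(** The Taylor remainders below are linear in the coefficients of [Q]; only the remainders of the
    monomials, taken as weights, have to be bounded. *)
Lemma weighted_bound (w : nat -> C) (W : R) :
  (forall i, (i < n)%N -> normc (w i) <= W) ->
  normc (\sum_(i < n) Q`_i * w i) <= n%:R * M * W.
Proof.
move=> ww; apply: le_trans (normc_sum _ _ _) _.
apply: (@le_trans _ _ (\sum_(i < n) (M * W))).
  apply: ler_sum => j _; rewrite normcM.
  by apply: ler_pM; rewrite ?normc_ge0//; exact: ww.
by rewrite sumr_const card_ord -mulrA mulr_natl.
Qed.

Lemma hornerW x : Q.[x] = \sum_(i < n) Q`_i * x ^+ i.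
Proof. exact: horner_coef_wide. Qed.

Lemma horner_derivW x : Q^`().[x] = \sum_(i < n) Q`_i * (x ^+ i.-1 *+ i).
Proof.
have QE : Q = \sum_(i < n) Q`_i *: 'X^i.
  apply/polyP => k; rewrite coef_sum; have [kn|nk] := ltnP k n.
    rewrite (bigD1 (Ordinal kn))//= coefZ coefXn eqxx mulr1 big1 ?addr0// => i ik.
    by rewrite coefZ coefXn eq_sym (negPf (_ : (i : nat) != k)) ?mulr0.
  rewrite nth_default ?big1//; last exact: leq_trans sQ nk.
  move=> i _; rewrite coefZ coefXn gtn_eqF ?mulr0//.
  exact: leq_trans (ltn_ord i) nk.
rewrite {1}QE raddf_sum /= horner_sum; apply: eq_bigr => i _.
by rewrite derivZ derivXn hornerZ hornerMn hornerXn.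
Qed.

Let expa_le i k : (k <= i)%N -> normc a ^+ i <= normc a ^+ k.
Proof. by move=> ki; rewrite ler_wiXn2l ?normc_ge0. Qed.

Lemma taylor0 : normc (Q.[a] - Q.[0]) <= n%:R * M * normc a.
Proof.
rewrite !hornerW -sumrB (eq_bigr _ (fun i _ => esym (mulrBr _ _ _))).
apply: (weighted_bound (w := fun i => a ^+ i - 0 ^+ i)) => -[|i] _.
  by rewrite !expr0 subrr normc0 normc_ge0.
by rewrite expr0n/= subr0 normcX (@expa_le i.+1 1).
Qed.

Lemma taylor1 : normc (Q.[a] - Q.[0] - a * Q^`().[0]) <= n%:R * M * normc a ^+ 2.
Proof.
rewrite !hornerW horner_derivW mulr_sumr -!sumrB.
rewrite (eq_bigr (fun i : 'I_n => Q`_i * (a ^+ i - 0 ^+ i - a * (0 ^+ i.-1 *+ i)))).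
  apply: (weighted_bound (w := fun i => a ^+ i - 0 ^+ i - a * (0 ^+ i.-1 *+ i))).
  move=> [|[|i]] _ /=.
  - by rewrite !expr0 subrr mulr0n mulr0 subr0 normc0 exprn_ge0 ?normc_ge0.
  - by rewrite !expr0 expr0n/= subr0 mulr1 subrr normc0 exprn_ge0 ?normc_ge0.
  - by rewrite !expr0n/= mul0rn mulr0 !subr0 normcX expa_le.
by move=> i _; ring.
Qed.

(* The error of the trapezoid rule. *)
Lemma taylor3 : normc ((Q.[a] - Q.[0]) *+ 2 - a * (Q^`().[0] + Q^`().[a]))
  <= n%:R * M * (n.+2%:R * normc a ^+ 3).
Proof.
rewrite !hornerW !horner_derivW -big_split /= mulr_sumr -sumrB -sumrMnl -sumrB.
rewrite (eq_bigr (fun i : 'I_n => Q`_i *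
   ((a ^+ i - 0 ^+ i) *+ 2 - a * (0 ^+ i.-1 *+ i + a ^+ i.-1 *+ i)))); last first.
  by move=> i _; ring.
apply: (weighted_bound
  (w := fun i => (a ^+ i - 0 ^+ i) *+ 2 - a * (0 ^+ i.-1 *+ i + a ^+ i.-1 *+ i))).
have W0 : 0 <= n.+2%:R * normc a ^+ 3 by rewrite mulr_ge0 ?exprn_ge0 ?normc_ge0.
(* The trapezoid rule is exact in degrees 0, 1 and 2; in degree [i.+3] the weight is (2 - (i + 3))
   a^(i + 3). *)
move=> [|[|[|i]]] lin /=.
- by rewrite !expr0 subrr mul0rn !mulr0n addr0 mulr0 subr0 normc0.
- rewrite (_ : normc _ = 0)//; apply/eqP; rewrite -(normc0 R); apply/eqP.
  by congr normc; rewrite expr0n/= !expr0; ring.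
- rewrite (_ : normc _ = 0)//; apply/eqP; rewrite -(normc0 R); apply/eqP.
  by congr normc; rewrite !expr0n/=; ring.
- rewrite [X in normc X](_ : _ = (2%:R - i.+3%:R) * a ^+ i.+3); last first.
    by rewrite !expr0n/= subr0 mul0rn add0r mulrnAr -exprS mulrBl !mulr_natl.
  rewrite normcM normcX ler_pM ?exprn_ge0 ?normc_ge0 ?expa_le//.
  rewrite -(rmorph_nat rc 2) -(rmorph_nat rc i.+3) -rmorphB normc_real.
  rewrite distrC -natrB// normr_nat ler_nat; move: lin; lia.
Qed.

End OnePoly.
End Taylor.

(** * Two nearby tangent lines *)

(** The indices are parameters because the estimates serve every affine chart, and also the chart
    with [j] and [k] exchanged. *)
Definition row3 (K : pzRingType) (i j : 'I_3) (a b c : K) : 'rV[K]_3 :=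
  \row_m (if m == i then a else if m == j then b else c).

Lemma rowZ (K : pzRingType) n (a : K) (v : 'rV[K]_n) x : (a *: v) 0 x = a * v 0 x.
Proof. by rewrite mxE. Qed.

Section Row3.
Variables i j k : 'I_3.
Hypotheses (ij : i != j) (ik : i != k) (jk : j != k).

Lemma ord3_cases m : [\/ m = i, m = j | m = k].
Proof.
suff: [|| m == i, m == j | m == k].
  by case/or3P => /eqP; [constructor 1|constructor 2|constructor 3].
move: i j k m ij ik jk.
by do 4![move=> [[|[|[|//]]] ?]].
Qed.

Lemma sum3 (V : nmodType) (F : 'I_3 -> V) : \sum_m F m = F i + F j + F k.
Proof.
rewrite (bigD1 i)//= (bigD1 j) 1?eq_sym//= (big_pred1 k) ?addrA// => m /=.
have [->|->|->] := ord3_cases m.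
- by rewrite eqxx (negPf ik).
- by rewrite eqxx (negPf jk) andbF.
- by rewrite !(eq_sym k) ik jk eqxx.
Qed.

Section Entries.
Variables (K : pzRingType) (a b c : K).

Lemma row3_i : row3 i j a b c 0 i = a. Proof. by rewrite mxE eqxx. Qed.
Lemma row3_j : row3 i j a b c 0 j = b.
Proof. by rewrite mxE eq_sym (negPf ij) eqxx. Qed.
Lemma row3_k : row3 i j a b c 0 k = c.
Proof. by rewrite mxE eq_sym (negPf ik) eq_sym (negPf jk). Qed.

Lemma row3_eq (v : 'rV[K]_3) : v 0 i = a -> v 0 j = b -> v 0 k = c -> v = row3 i j a b c.
Proof.
move=> va vb vc; apply/rowP => m.
by have [->|->|->] := ord3_cases m; rewrite ?(row3_i, row3_j, row3_k).
Qed.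

End Entries.
End Row3.

Section TangentPair.
Variables (R : realType) (i j k : 'I_3).
Hypotheses (ij : i != j) (ik : i != k) (jk : j != k).
Local Notation C := (complex R).
Local Notation rc := (real_complex R).

(* Tangency of the line with coordinates 1, t, u (at i, j, k) at the point with
   coordinates z, 1, s; the last clause, incidence, is Euler's relation. *)
Definition tangent_data (f : tpoly C) (t u : R) (s z l : C) : Prop :=
  [/\ evalf f (row3 i j z 1 s) = 0,
      gradient f (row3 i j z 1 s) = l *: row3 i j 1 (rc t) (rc u) &
      z + rc t + rc u * s = 0].

(** Both points lie on the curve, so the trapezoid rule gives l1 D1 + l2 D2 = O(eta^3), where l D is
    the differential of f applied to the displacement. First-order Taylor gives D2 = O(eta^2), and
    l2 - l1 = O(eta), whence l1 (D1 + D2) = O(eta^3). By incidence, D1 + D2 is minus the quantity to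
    be bounded. *)
Lemma pair_estimate (f : tpoly C) (B c : R) : 1 <= B -> 0 < c ->
  exists K, 0 <= K /\ forall t1 u1 s1 z1 l1 t2 u2 s2 z2 l2 eta,
    tangent_data f t1 u1 s1 z1 l1 -> tangent_data f t2 u2 s2 z2 l2 ->
    c <= normc l1 -> c <= normc l2 ->
    normc s1 <= B -> normc s2 <= B -> normc z1 <= B -> normc z2 <= B ->
    0 < eta -> eta <= 1 -> normc (s2 - s1) <= eta -> normc (z2 - z1) <= eta ->
  normc (rc (t2 - t1) *+ 2 + rc (u2 - u1) * (s1 + s2)) <= K * eta ^+ 3.
Proof.
move=> B1 c0.
have [n [M [M0 HM]]] := line_poly_bound f B.
have [n' [M' [M'0 HM']]] := line_poly_bound (mderiv i f) B.
pose A := n%:R * M; pose A' := n'%:R * M'.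
have A0 : 0 <= A by rewrite mulr_ge0.
have A'0 : 0 <= A' by rewrite mulr_ge0.
exists ((A * n.+2%:R + A' * (A / c)) / c); split.
  by rewrite divr_ge0 ?(ltW c0)// addr_ge0// !mulr_ge0// invr_ge0 ltW.
move=> t1 u1 s1 z1 l1 t2 u2 s2 z2 l2 eta [f1 g1 e1] [f2 g2 e2] cl1 cl2
  Bs1 Bs2 Bz1 Bz2 eta0 eta1 hs hz.
set p1 := row3 i j z1 1 s1 in f1 g1; set p2 := row3 i j z2 1 s2 in f2 g2.
have etaC : rc eta != 0 by rewrite fmorph_eq0 gt_eqF.
have neta : normc (rc eta) = eta by rewrite normc_real gtr0_norm.
have Bp (z s : C) : normc z <= B -> normc s <= B ->
    forall m, normc (row3 i j z 1 s 0 m) <= B.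
  move=> bz bs m; have [->|->|->] := ord3_cases ij ik jk m.
  - by rewrite row3_i.
  - by rewrite row3_j ?normc1.
  - by rewrite row3_k.
(* Dividing the displacement by [eta] keeps the direction in the box of [line_poly_bound]; [eta]
   becomes the Taylor parameter. *)
pose m := row3 i j ((z2 - z1) / rc eta) 0 ((s2 - s1) / rc eta).
have Bq (x : C) : normc x <= eta -> normc (x / rc eta) <= B.
  move=> xe; rewrite normcM normcV neta; apply: le_trans B1.
  by rewrite ler_pdivrMr// mul1r.
have Bm x : normc (m 0 x) <= B.
  have [->|->|->] := ord3_cases ij ik jk x.
  - by rewrite row3_i; exact: Bq.
  - by rewrite row3_j ?normc0// (le_trans ler01).
  - by rewrite row3_k//; exact: Bq.
have BNm x : normc ((- m) 0 x) <= B by rewrite mxE normc_opp.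
have p12 : p1 + rc eta *: m = p2.
  apply: (row3_eq ij ik jk); rewrite mxE rowZ /p1 /m.
  - by rewrite !row3_i mulrC divfK// addrC subrK.
  - by rewrite !row3_j// mulr0 addr0.
  - by rewrite !row3_k// mulrC divfK// addrC subrK.
have p21 : p2 + rc eta *: - m = p1 by rewrite -p12 scalerN addrK.
pose D1 := (z2 - z1) + rc u1 * (s2 - s1).
pose D2 := (z2 - z1) + rc u2 * (s2 - s1).
have grad_m l t u p : gradient f p = l *: row3 i j 1 (rc t) (rc u) ->
    \sum_x m 0 x * gradient f p 0 x =
    l * ((z2 - z1) + rc u * (s2 - s1)) / rc eta.
  move=> ->; rewrite (sum3 ij ik jk) !rowZ /m.
  by rewrite !row3_i !row3_j// !row3_k//; ring.
have [sQ bQ] := HM p1 m (Bp _ _ Bz1 Bs1) Bm.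
have [sN bN] := HM p2 (- m) (Bp _ _ Bz2 Bs2) BNm.
have [sG bG] := HM' p1 m (Bp _ _ Bz1 Bs1) Bm.
have aeta : normc (rc eta) <= 1 by rewrite neta.
have D1e : normc D1 <= A / c * eta ^+ 2.
  have := taylor1 sQ bQ aeta.
  rewrite horner_deriv_line_poly !horner_line_poly p12 scale0r addr0 f1 f2 subrr.
  rewrite (grad_m _ _ _ _ g1) mulrC divfK// sub0r normc_opp normcM neta => h.
  rewrite mulrAC ler_pdivlMr// mulrC; apply: le_trans h.
  by rewrite ler_wpM2r// normc_ge0.
have D2e : normc D2 <= A / c * eta ^+ 2.
  have := taylor1 sN bN aeta.
  rewrite horner_deriv_line_poly !horner_line_poly p21 scale0r addr0 f1 f2 subrr.
  rewrite (eq_bigr (fun x => - (m 0 x * gradient f p2 0 x))); last first.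
    by move=> x _; rewrite mxE mulNr.
  rewrite sumrN (grad_m _ _ _ _ g2) mulrN mulrC divfK// sub0r opprK normcM neta => h.
  rewrite mulrAC ler_pdivlMr// mulrC; apply: le_trans h.
  by rewrite ler_wpM2r// normc_ge0.
(* The line has coordinate 1 at [i], so [l] is the partial derivative of [f] in direction [i]. *)
have l12 : normc (l2 - l1) <= A' * eta.
  have := taylor0 sG bG aeta; rewrite !horner_line_poly p12 scale0r addr0 neta.
  have gi p l t u : gradient f p = l *: row3 i j 1 (rc t) (rc u) ->
      evalf (mderiv i f) p = l.
    by move=> /rowP/(_ i); rewrite mxE => ->; rewrite rowZ row3_i mulr1.
  by rewrite (gi _ _ _ _ g1) (gi _ _ _ _ g2).
have T3 : normc (l1 * D1 + l2 * D2) <= A * (n.+2%:R * eta ^+ 3).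
  have := taylor3 sQ bQ aeta.
  rewrite !horner_deriv_line_poly !horner_line_poly p12 scale0r addr0 f1 f2 subrr.
  rewrite mul0rn sub0r normc_opp (grad_m _ _ _ _ g1) (grad_m _ _ _ _ g2).
  by rewrite -mulrDl mulrC divfK// neta.
have -> : rc (t2 - t1) *+ 2 + rc (u2 - u1) * (s1 + s2) = - (D1 + D2).
  have E (z t u s : C) : z + t + u * s = 0 -> t = - (z + u * s).
    by move=> e; rewrite -[RHS]addr0 -e; ring.
  rewrite /D1 /D2 !rmorphB /= (E _ _ _ _ e1) (E _ _ _ _ e2); ring.
rewrite normc_opp.
have : normc (l1 * (D1 + D2)) <= (A * n.+2%:R + A' * (A / c)) * eta ^+ 3.
  have -> : l1 * (D1 + D2) = (l1 * D1 + l2 * D2) - (l2 - l1) * D2 by ring.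
  apply: le_trans (normcB _ _) _; rewrite [X in _ <= X]mulrDl; apply: lerD; first by rewrite -mulrA.
  rewrite normcM exprS.
  have -> : A' * (A / c) * (eta * eta ^+ 2) = (A' * eta) * (A / c * eta ^+ 2) by ring.
  by apply: ler_pM; rewrite ?normc_ge0.
rewrite normcM => h; rewrite mulrAC ler_pdivlMr// mulrC.
by apply: le_trans h; rewrite ler_wpM2r// normc_ge0.
Qed.

(** As the lines are real, the imaginary part of [pair_estimate] isolates u2 - u1, with a factor Im
    (s1 + s2) bounded away from 0; the real part then controls t2 - t1. Incidence bounds z2 - z1 by
    s2 - s1 up to a cubic term, so [eta] can be traded for the distance of [s1] and [s2]. *)
Lemma pair_cubic (f : tpoly C) (B c c0 : R) : 1 <= B -> 0 < c -> 0 < c0 ->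
  exists K rho, 0 <= K /\ 0 < rho /\ forall t1 u1 s1 z1 l1 t2 u2 s2 z2 l2,
    tangent_data f t1 u1 s1 z1 l1 -> tangent_data f t2 u2 s2 z2 l2 ->
    c <= normc l1 -> c <= normc l2 ->
    normc s1 <= B -> normc s2 <= B -> normc z1 <= B -> normc z2 <= B ->
    `|u1| <= B -> c0 <= `|complex.Im s1| -> c0 <= `|complex.Im s2| ->
    normc (s2 - s1) <= rho -> normc (z2 - z1) <= rho ->
  `|t2 - t1| <= K * normc (s2 - s1) ^+ 3.
Proof.
move=> B1 cp c0p; have [K [K0 HK]] := pair_estimate f B1 cp.
pose K3 := K / c0; pose K4 := K + K3 * (2 * B); pose K5 := K4 + B * K3.
have B0 : 0 <= B by apply: le_trans B1.
have K30 : 0 <= K3 by rewrite divr_ge0// ltW.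
have K40 : 0 <= K4 by rewrite addr_ge0// mulr_ge0// mulr_ge0.
have K50 : 0 <= K5 by rewrite addr_ge0// mulr_ge0.
(* For eta <= 2 * r1 this gives K5 * eta <= 1 / 2, so that the cubic term is at most eta / 2 and can
   be absorbed. *)
pose r1 := (4 * (K5 + 1))^-1.
have r10 : 0 < r1 by rewrite invr_gt0 mulr_gt0// ltr_wpDl.
have r1E : r1 * K5 + r1 = 4^-1.
  by rewrite /r1; field; rewrite gt_eqF// ltr_wpDl.
have KB0 : 0 <= K4 * (2 * (1 + B)) ^+ 3.
  by apply: mulr_ge0 => //; apply: exprn_ge0; rewrite mulr_ge0// addr_ge0.
exists (K4 * (2 * (1 + B)) ^+ 3), (Num.min c0 r1); split => //.
split; first by rewrite lt_min c0p.
move=> t1 u1 s1 z1 l1 t2 u2 s2 z2 l2 T1 T2 cl1 cl2 Bs1 Bs2 Bz1 Bz2 Bu I1 I2.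
rewrite !le_min => /andP[hc0 hr] /andP[_ kr].
set h := normc (s2 - s1) in hc0 hr *; set kk := normc (z2 - z1) in kr.
have h0 : 0 <= h := normc_ge0 _; have kk0 : 0 <= kk := normc_ge0 _.
(* [pair_estimate] wants a positive [eta]; if the two points coincide, so do their gradients, and
   [t1] equals [t2]. *)
have [eta0|] := ltP 0 (h + kk); last first.
  move=> hk; have hz : h = 0 by lra.
  have kz : kk = 0 by lra.
  have es : s1 = s2 by move/eqP: (eq0_normc hz); rewrite subr_eq0 => /eqP.
  have ez : z1 = z2 by move/eqP: (eq0_normc kz); rewrite subr_eq0 => /eqP.
  case: T1 => _ + _; case: T2 => _ + _; rewrite es ez => -> /rowP H.
  have := H i; have := H j; rewrite !rowZ !row3_i !row3_j// !mulr1 => + ll.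
  rewrite ll => /mulfI tt; have {}tt : rc t2 = rc t1.
    by apply: tt; apply/eqP => l10; move: cl1; rewrite l10 normc0 leNgt cp.
  have -> : t2 = t1 by case: tt.
  by rewrite subrr normr0; apply: mulr_ge0 => //; exact: exprn_ge0.
set eta := h + kk in eta0.
have eta1 : eta <= 1 by rewrite /eta; nra.
have he : h <= eta by rewrite lerDl.
have ke : kk <= eta by rewrite lerDr.
have := HK _ _ _ _ _ _ _ _ _ _ _ T1 T2 cl1 cl2 Bs1 Bs2 Bz1 Bz2 eta0 eta1 he ke.
set E := _ + _ => EK.
have ReE : complex.Re E = (t2 - t1) *+ 2 + (u2 - u1) * (complex.Re s1 + complex.Re s2).
  by rewrite /E; case: (s1) => a b; case: (s2) => a' b' /=; ring.
have ImE : complex.Im E = (u2 - u1) * (complex.Im s1 + complex.Im s2).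
  by rewrite /E; case: (s1) => a b; case: (s2) => a' b' /=; ring.
have e30 : 0 <= eta ^+ 3 by rewrite exprn_ge0// ltW.
(* Imaginary parts of size at least [c0] and at distance at most [c0] have the same sign, so they
   add up without cancellation. *)
have Im12 : c0 <= `|complex.Im s1 + complex.Im s2|.
  have : `|complex.Im s2 - complex.Im s1| <= c0.
    apply: le_trans hc0; apply: le_trans (normc_Im (s2 - s1)).
    by case: (s1) => a b; case: (s2).
  move: I1 I2; move: (complex.Im s1) (complex.Im s2) => x y.
  clear -c0p; rewrite ler_norml => Ix Iy /andP[a b].
  rewrite ler_normr; case: (ger0P x) Ix; case: (ger0P y) Iy => *; apply/orP; lra.
have du : `|u2 - u1| <= K3 * eta ^+ 3.
  rewrite mulrAC ler_pdivlMr//; apply: le_trans EK.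
  by apply: le_trans (normc_Im E); rewrite ImE normrM ler_wpM2l.
have dt : `|t2 - t1| <= K4 * eta ^+ 3.
  have : `|complex.Re E| <= K * eta ^+ 3 := le_trans (normc_Re _) EK.
  have : `|(u2 - u1) * (complex.Re s1 + complex.Re s2)| <= K3 * eta ^+ 3 * (2 * B).
    rewrite normrM ler_pM//; apply: le_trans (ler_normD _ _) _.
    by rewrite mulr_natl mulr2n lerD// (le_trans (normc_Re _)).
  have -> : K4 * eta ^+ 3 = K * eta ^+ 3 + K3 * eta ^+ 3 * (2 * B) by rewrite /K4; ring.
  rewrite ReE; set X := _ * (_ + _); set Y := K3 * _ * _; set Z := K * _.
  set T := t2 - t1; clear; rewrite !ler_norml => /andP[a b] /andP[a' b'].
  by apply/andP; split; lra.
have kB : kk <= K5 * eta ^+ 3 + B * h.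
  have -> : kk = normc (rc (t2 - t1) + rc (u2 - u1) * s2 + rc u1 * (s2 - s1)).
    case: T1 => _ _ e1; case: T2 => _ _ e2; rewrite /kk -normc_opp; congr normc.
    rewrite -[LHS]addr0 -[X in _ + X](subrr 0) -{1}e2 -e1 !rmorphB /=; ring.
  apply: le_trans (normcD _ _) _; apply: lerD.
    apply: le_trans (normcD _ _) _; rewrite normcM !normc_real /K5 mulrDl lerD//.
    by rewrite mulrC -mulrA ler_pM// normc_ge0.
  by rewrite normcM normc_real ler_wpM2r.
have e2 : K5 * eta ^+ 3 <= eta / 2.
  have H : K5 * eta <= 2^-1.
    have : K5 * eta <= K5 * (r1 + r1) by rewrite ler_wpM2l// lerD.
    by clear -r1E r10; lra.
  have -> : K5 * eta ^+ 3 = (K5 * eta) * eta * eta by ring.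
  have : K5 * eta * eta <= 2^-1 by rewrite -[leRHS]mulr1 ler_pM// ?mulr_ge0// ltW.
  by move=> /(ler_wpM2r (ltW eta0)); rewrite [2^-1 * _]mulrC.
have eh : eta <= 2 * (1 + B) * h by have : eta = h + kk by []; clear -kB e2; lra.
apply: le_trans dt _; rewrite -mulrA ler_wpM2l// -exprMn.
by rewrite ler_pXn2r// nnegrE ?(ltW eta0)// mulr_ge0// mulr_ge0// addr_ge0.
Qed.

End TangentPair.

(* Values of [s] in a common cell of an n x n grid are within O(1/n), hence the
   corresponding parameters are within O(1/n^3), too close for more than n^2
   equidistant parameters. *)
Lemma no_cubic_family (R : realType) (a b B K rho : R) (s : R -> complex R) :
  a < b -> 0 < B -> 0 < rho -> 0 <= K ->
  (forall t, a < t < b -> normc (s t) <= B) ->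
  (forall t t', a < t < b -> a < t' < b -> normc (s t' - s t) <= rho ->
     `|t' - t| <= K * normc (s t' - s t) ^+ 3) -> False.
Proof.
move=> ab B0 rho0 K0 sB sK.
have ba0 : 0 < b - a by rewrite subr_gt0.
(* For n above the second summand, values in a common cell are [rho]-close; the third, with 384 = 6
   * 4 ^ 3, makes K (4 B / n)^3 smaller than (b - a) / (6 n^2). *)
pose X := 1 + 4 * B / rho + 384 * K * B ^+ 3 / (b - a).
have rB : 0 <= 4 * B / rho by rewrite divr_ge0 ?mulr_ge0 ?ltW.
have KB : 0 <= 384 * K * B ^+ 3 / (b - a).
  apply: divr_ge0; last exact: ltW.
  apply: mulr_ge0; last by rewrite exprn_ge0// ltW.
  by apply: mulr_ge0; [exact: ler0n|].
pose n := (Num.truncn X).+1.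
have nX : X < n%:R by rewrite /n; exact: truncnS_gt.
have n1 : 1 <= n%:R :> R by rewrite ler1n.
have n0 : 0 < n%:R :> R by apply: lt_le_trans n1.
(* One parameter more than there are cells. Each coordinate has n + 1 cells, since its truncation
   attains n at the right end [B]. *)
pose N := (n.+1 * n.+1).+1.
pose tt (m : 'I_N) := a + (b - a) * (m.+1%:R / N.+1%:R).
have ttab m : a < tt m < b.
  rewrite /tt ltrDl mulr_gt0 ?divr_gt0//=.
  rewrite -ltrBrDl gtr_pMr// ltr_pdivrMr// mul1r ltr_nat ltnS; exact: ltn_ord.
pose cell (x : R) := (x + B) * (n%:R / (2 * B)).
have cell_ge0 x : `|x| <= B -> 0 <= cell x.
  rewrite ler_norml => /andP[h _]; apply: mulr_ge0; first by lra.
  by rewrite divr_ge0 ?mulr_ge0// ltW.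
have cell_lt x : `|x| <= B -> (Num.truncn (cell x) < n.+1)%N.
  move=> xB; rewrite truncn_lt_nat ?cell_ge0//.
  apply: (@le_lt_trans _ _ n%:R); last by rewrite ltr_nat.
  rewrite /cell mulrA ler_pdivrMr ?mulr_gt0// mulrC ler_pM2l//.
  by move: xB; rewrite ler_norml => /andP[_ h]; lra.
have cell_eq x y : `|x| <= B -> `|y| <= B ->
    Num.truncn (cell x) = Num.truncn (cell y) -> `|y - x| <= 2 * B / n%:R.
  move=> xB yB e; have := truncn_itv (cell_ge0 _ xB).
  have := truncn_itv (cell_ge0 _ yB); rewrite e; move: (Num.truncn _) => q.
  rewrite -[q.+1%:R]natr1 => /andP[h1 h2] /andP[h3 h4].
  have : `|cell y - cell x| <= 1 by rewrite ler_norml; apply/andP; split; lra.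
  have -> : cell y - cell x = (y - x) * (n%:R / (2 * B)) by rewrite /cell; ring.
  rewrite normrM [`|n%:R / _|]gtr0_norm ?divr_gt0 ?mulr_gt0//.
  by rewrite -ler_pdivlMr ?divr_gt0 ?mulr_gt0// invf_div mul1r.
have sRe m : `|complex.Re (s (tt m))| <= B := le_trans (normc_Re _) (sB _ (ttab m)).
have sIm m : `|complex.Im (s (tt m))| <= B := le_trans (normc_Im _) (sB _ (ttab m)).
pose phi m := (Ordinal (cell_lt _ (sRe m)), Ordinal (cell_lt _ (sIm m))).
have /injectivePn[m [m' mm' [e1 e2]]] : ~~ injectiveb phi.
  apply/negP => /injectiveP/leq_card.
  by rewrite card_prod !card_ord ltnn.
have hn : normc (s (tt m') - s (tt m)) <= 4 * B / n%:R.
  apply: le_trans (normc_le_ReIm _) _.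
  have -> : 4 * B / n%:R = 2 * B / n%:R + 2 * B / n%:R by ring.
  have := cell_eq _ _ (sRe m) (sRe m') e1; have := cell_eq _ _ (sIm m) (sIm m') e2.
  by case: (s (tt m)) => ? ?; case: (s (tt m')) => ? ? /= ? ?; exact: lerD.
have hrho : normc (s (tt m') - s (tt m)) <= rho.
  apply: le_trans hn _; rewrite ler_pdivrMr// [rho * _]mulrC -ler_pdivrMr//.
  by move: nX; rewrite /X; lra.
have := sK _ _ (ttab m) (ttab m') hrho; apply/negP; rewrite -ltNge.
(* The chain is K (4 B / n)^3 < (b - a) / (6 n^2) <= (b - a) / (N + 1), the last being the spacing
   of the parameters. *)
apply: (@le_lt_trans _ _ (K * (4 * B / n%:R) ^+ 3)).
  by rewrite ler_wpM2l// ler_pXn2r ?nnegrE ?normc_ge0// divr_ge0 ?mulr_ge0// ltW.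
apply: (@lt_le_trans _ _ ((b - a) / N.+1%:R)); last first.
  have -> : tt m' - tt m = (b - a) / N.+1%:R * (m'%:R - m%:R).
    by rewrite /tt -[m.+1%:R]natr1 -[m'.+1%:R]natr1; ring.
  rewrite normrM gtr0_norm ?divr_gt0//.
  apply: ler_peMr; first by rewrite ltW// divr_gt0.
  have mmn : (m : nat) != m' by [].
  rewrite ler_normr; apply/orP; case: (ltngtP m m') mmn => // h _; [left|right].
    by rewrite lerBrDl natr1 ler_nat.
  by rewrite opprB lerBrDl natr1 ler_nat.
have N6 : N.+1%:R <= 6 * n%:R ^+ 2 :> R.
  have E q : ((q.+1 * q.+1).+2 = q * q + 2 * q + 3)%N.
    by clear; rewrite mulSn mulnS; lia.
  rewrite /N E.
  rewrite !natrD !natrM.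
  by clear -n1; move: (n%:R : R) n1 => x; nra.
apply: (@lt_le_trans _ _ ((b - a) / (6 * n%:R ^+ 2))); last first.
  by rewrite ler_pM2l// lef_pV2 ?posrE ?mulr_gt0 ?exprn_gt0.
rewrite expr_div_n mulrA ltr_pdivrMr ?exprn_gt0//.
have -> : (b - a) / (6 * n%:R ^+ 2) * n%:R ^+ 3 = (b - a) / 6 * n%:R.
  by field; rewrite gt_eqF.
rewrite -ltr_pdivrMl ?divr_gt0//; apply: le_lt_trans nX.
have -> : ((b - a) / 6)^-1 * (K * (4 * B) ^+ 3) = 384 * K * B ^+ 3 / (b - a).
  by field; rewrite gt_eqF.
by rewrite /X; lra.
Qed.

(** * Compactness *)

Section Continuity.
Variables (R : realType) (T : topologicalType).
Local Notation C := (complex R).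
Implicit Types f g : T -> R.

Lemma ctsC (c : R) : continuous (fun _ : T => c).
Proof. by move=> x; exact: cvg_cst. Qed.
Lemma ctsD f g : continuous f -> continuous g -> continuous (fun x => f x + g x).
Proof. by move=> cf cg x; apply: cvgD; [exact: cf | exact: cg]. Qed.
Lemma ctsM f g : continuous f -> continuous g -> continuous (fun x => f x * g x).
Proof. by move=> cf cg x; apply: cvgM; [exact: cf | exact: cg]. Qed.
Lemma ctsN f : continuous f -> continuous (fun x => - f x).
Proof. by move=> cf x; apply: cvgN; exact: cf. Qed.
Lemma ctsB f g : continuous f -> continuous g -> continuous (fun x => f x - g x).
Proof. by move=> cf cg; apply: ctsD => //; exact: ctsN. Qed.
Lemma cts_sqr f : continuous f -> continuous (fun x => f x ^+ 2).
Proof. by move=> cf; apply: ctsM. Qed.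
Lemma cts_sum (I : Type) (r : seq I) (P : pred I) (F : I -> T -> R) :
  (forall i, continuous (F i)) -> continuous (fun x => \sum_(i <- r | P i) F i x).
Proof.
move=> cF; elim: r => [|i r IH].
  by under eq_fun do rewrite big_nil; exact: ctsC.
under eq_fun do rewrite big_cons.
by case: (P i) => //; apply: ctsD.
Qed.

(** Continuity through real and imaginary parts, so that no topology on the complex numbers
    enters. *)
Definition ccts (g : T -> C) : Prop :=
  continuous (fun x => complex.Re (g x)) /\ continuous (fun x => complex.Im (g x)).

Lemma cctsC c : ccts (fun=> c). Proof. by split; exact: ctsC. Qed.
Lemma cctsD (f g : T -> C) : ccts f -> ccts g -> ccts (fun x => f x + g x).
Proof.
move=> [f1 f2] [g1 g2]; split.
  by under eq_fun do rewrite Re_add; exact: ctsD.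
by under eq_fun do rewrite Im_add; exact: ctsD.
Qed.
Lemma cctsM (f g : T -> C) : ccts f -> ccts g -> ccts (fun x => f x * g x).
Proof.
move=> [f1 f2] [g1 g2]; split.
  by under eq_fun do rewrite Re_mul; apply: ctsB; exact: ctsM.
by under eq_fun do rewrite Im_mul; apply: ctsD; exact: ctsM.
Qed.

Lemma ccts_evalf (p : tpoly C) (v : T -> 'rV[C]_3) :
  (forall i, ccts (fun x => v x 0 i)) -> ccts (fun x => evalf p (v x)).
Proof.
move=> cv; rewrite /evalf; elim/mpoly_alg_ind: p => [a|i|p q Hp Hq|p q Hp Hq].
- by under eq_fun do rewrite mevalC; exact: cctsC.
- by under eq_fun do rewrite mevalXU; exact: cv.
- by under eq_fun do rewrite mevalD; exact: cctsD.
- by under eq_fun do rewrite mevalM; exact: cctsM.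
Qed.

Lemma cts_evalf (p : tpoly R) (v : T -> 'rV[R]_3) :
  (forall i, continuous (fun x => v x 0 i)) -> continuous (fun x => evalf p (v x)).
Proof.
move=> cv; rewrite /evalf; elim/mpoly_alg_ind: p => [a|i|p q Hp Hq|p q Hp Hq].
- by under eq_fun do rewrite mevalC; exact: ctsC.
- by under eq_fun do rewrite mevalXU; exact: cv.
- by under eq_fun do rewrite mevalD; exact: ctsD.
- by under eq_fun do rewrite mevalM; exact: ctsM.
Qed.

End Continuity.

Definition box (R : realType) n (B : R) : set 'rV[R]_n :=
  [set w | forall m, `[- B, B]%classic (w 0 m)].

Lemma box_compact (R : realType) n (B : R) : compact (@box R n B).
Proof. by apply: (@rV_compact _ _ (fun=> `[- B, B]%classic)) => _; exact: segment_compact. Qed.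

(** The source of the uniform constants. A system of closed conditions without solution in the box
    is encoded as a sum of squares [phi], positive there; compactness provides a margin that
    survives a small change of [t]. *)
Lemma tube_pos (R : realType) (T : topologicalType) n (B : R) (t0 : T)
    (phi : T * 'rV[R]_n -> R) : continuous phi ->
  (forall w, box B w -> 0 < phi (t0, w)) ->
  exists2 c, 0 < c & \forall t \near t0, forall w, box B w -> c <= phi (t, w).
Proof.
move=> cphi pos.
have /compact_near_coveringP nc := @box_compact R n B.
(* The bound is a second parameter, tending to 0 from the right, so that one covering argument
   yields both the margin and the neighbourhood. *)
pose P (ct : R * T) w := ct.1 <= phi (ct.2, w).
have [[A D] /= [nA nD] sub] : \forall ct \near filter_prod (0^'+) (nbhs t0),
    @box R n B `<=` P ct.
  apply: (nc _ _ P) => w bw; have e0 := pos w bw.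
  have [[A D] [/= nA nD] sub] : nbhs (t0, w) [set p | phi (t0, w) / 2 < phi p].
    have e2 : phi (t0, w) / 2 < phi (t0, w) by rewrite ltr_pdivrMr// ltr_pMr// ltr1n.
    exact: (cphi (t0, w) _ (lt_nbhsr e2)).
  exists (D, [set ct | ct.1 < phi (t0, w) / 2 /\ A ct.2]) => /=.
    split => //; exists ([set c | c < phi (t0, w) / 2], A) => //=; split => //.
    by apply: nbhs_right_lt; rewrite divr_gt0.
  move=> [w' [c t]] /= [Dw [ce At]]; rewrite /P /=.
  by apply/ltW; apply: lt_trans ce _; exact: (sub (t, w')).
have [c [Ac c0]] : exists c, A c /\ 0 < c.
  by apply: (@filter_ex _ (0^'+)); apply: filterI => //; exact: nbhs_right_gt.
exists c => //; apply: filterS nD => t Dt w bw.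
exact: (sub (c, t)).
Qed.

Section Compactness.
Variables (R : realType).
Local Notation C := (complex R).
Local Notation rc := (real_complex R).

Definition dot (u v : 'rV[R]_3) : R := \sum_i u 0 i * v 0 i.
Definition csq (z : C) : R := complex.Re z ^+ 2 + complex.Im z ^+ 2.
(** The identification of R^6 with C^3, which brings the compactness of real boxes to complex
    points. *)
Definition cvec (w : 'rV[R]_(3 + 3)) : 'rV[C]_3 :=
  \row_m Complex (w 0 (lshift 3 m)) (w 0 (rshift 3 m)).
Definition sqlen n (w : 'rV[R]_n) : R := \sum_m w 0 m ^+ 2.

Lemma sum3_gt0 (a b c : R) : 0 <= a -> 0 <= b -> 0 <= c ->
  (a = 0 -> b = 0 -> c = 0 -> False) -> 0 < a + b + c.
Proof.
move=> a0 b0 c0 abc; rewrite lt_neqAle !addr_ge0// andbT eq_sym.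
apply/negP; rewrite !paddr_eq0 ?addr_ge0// => /andP[/andP[/eqP ? /eqP ?] /eqP ?].
exact: abc.
Qed.

Lemma csq_ge0 z : 0 <= csq z. Proof. by rewrite addr_ge0// sqr_ge0. Qed.
Lemma csq_eq0 z : csq z = 0 -> z = 0.
Proof.
move/eqP; rewrite paddr_eq0 ?sqr_ge0// !sqrf_eq0 => /andP[/eqP a /eqP b].
exact: complex_eqP.
Qed.
Lemma csqE z : csq z = normc z ^+ 2. Proof. by rewrite normc_sqr. Qed.
Lemma csqM x y : csq (x * y) = csq x * csq y.
Proof. by rewrite !csqE normcM exprMn. Qed.
Lemma sqlen_ge0 n (w : 'rV[R]_n) : 0 <= sqlen w.
Proof. by apply: sumr_ge0 => m _; exact: sqr_ge0. Qed.

Lemma sqlen_eq0 n (w : 'rV[R]_n) : sqlen w = 0 -> w = 0.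
Proof.
move=> /eqP; rewrite psumr_eq0 => [/allP h|m _]; last exact: sqr_ge0.
apply/rowP => m; rewrite mxE; have := h m; rewrite mem_index_enum => /(_ isT).
by rewrite sqrf_eq0 => /eqP.
Qed.

Lemma unit_neq0 n (w : 'rV[R]_n) : sqlen w = 1 -> w != 0.
Proof.
apply: contra_eq_neq => ->; rewrite /sqlen big1 => [|m _].
  by rewrite eq_sym oner_eq0.
by rewrite mxE expr0n.
Qed.

Lemma sqlen_gt0 n (w : 'rV[R]_n) : w != 0 -> 0 < sqlen w.
Proof.
by move=> w0; rewrite lt_neqAle sqlen_ge0 andbT eq_sym; apply: contra w0 => /eqP/sqlen_eq0 ->.
Qed.

Lemma coord_le_sqlen n (w : 'rV[R]_n) m : w 0 m ^+ 2 <= sqlen w.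
Proof.
by rewrite /sqlen (bigD1 m)//= lerDl; apply: sumr_ge0 => ? _; exact: sqr_ge0.
Qed.

Lemma box_sqlen n (w : 'rV[R]_n) B : 0 <= B -> sqlen w <= B ^+ 2 -> box B w.
Proof.
move=> B0 wB m /=; rewrite in_itv /= -ler_norml -(@ler_pXn2r _ 2)// real_normK ?num_real//.
exact: le_trans (coord_le_sqlen _ _) wB.
Qed.

Lemma unit_scale n (w : 'rV[R]_n) : w != 0 ->
  exists2 a, 0 < a & sqlen (a *: w) = 1.
Proof.
move=> w0; exists (Num.sqrt (sqlen w))^-1; first by rewrite invr_gt0 sqrtr_gt0 sqlen_gt0.
rewrite /sqlen; under eq_bigr do rewrite mxE exprMn exprVn sqr_sqrtr ?sqlen_ge0//.
by rewrite -mulr_sumr mulVf// gt_eqF// sqlen_gt0.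
Qed.

Lemma cvec_onto_box (p : 'rV[C]_3) B : (forall m, normc (p 0 m) <= B) ->
  exists2 w, cvec w = p & box B w.
Proof.
move=> pB; exists (row_mx (map_mx (@complex.Re R) p) (map_mx (@complex.Im R) p)).
  by apply/rowP => m; rewrite mxE row_mxEl row_mxEr !mxE -complex_eta.
move=> m /=; rewrite in_itv /= -ler_norml.
have [q ->|q ->] := split_ordP m; rewrite ?row_mxEl ?row_mxEr mxE.
  exact: le_trans (normc_Re _) (pB q).
exact: le_trans (normc_Im _) (pB q).
Qed.

Lemma cvec_onto (p : 'rV[C]_3) : exists w, cvec w = p.
Proof.
have [|w wp _] := @cvec_onto_box p (\sum_m normc (p 0 m)); last by exists w.
by move=> m; rewrite (bigD1 m)//= lerDl sumr_ge0// => *; exact: normc_ge0.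
Qed.

Lemma cvecZ a w : cvec (a *: w) = rc a *: cvec w.
Proof.
apply/rowP => m; rewrite !mxE; apply: complex_eqP => /=; rewrite ?mul0r; ring.
Qed.

Lemma cvec0 : cvec 0 = 0.
Proof. by apply/rowP => m; rewrite !mxE. Qed.

Lemma unit_cvec (p : 'rV[C]_3) : p != 0 ->
  exists w a, [/\ a != 0, cvec w = rc a *: p & sqlen w = 1].
Proof.
move=> p0; have [w wp] := cvec_onto p.
have w0 : w != 0 by apply: contraNneq p0 => w0; rewrite -wp w0 cvec0.
have [a a0 aw] := unit_scale w0.
by exists (a *: w), a; rewrite gt_eqF// cvecZ wp.
Qed.

Lemma unit_box n (w : 'rV[R]_n) : sqlen w = 1 -> box 1 w.
Proof. by move=> w1; apply: box_sqlen => //; rewrite w1 expr1n. Qed.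

Lemma cvec_neq0 w : sqlen w = 1 -> cvec w != 0.
Proof.
move=> w1; apply/eqP => /rowP w0; move: w1.
rewrite /sqlen big_split_ord /= !big1 ?addr0 => [/esym/eqP|m _|m _].
- by rewrite oner_eq0.
- by have := w0 m; rewrite !mxE => -[_ ->]; rewrite expr0n.
- by have := w0 m; rewrite !mxE => -[-> _]; rewrite expr0n.
Qed.

Section Cts.
Variables (m n : nat).
Local Notation X := ('rV[R]_m * 'rV[R]_n)%type.

Lemma cts_fst i : continuous (fun p : X => p.1 0 i).
Proof.
move=> p; apply: (@continuous_comp _ _ _ fst (fun v : 'rV[R]_m => v 0 i)).
  exact: cvg_fst.
exact: coord_continuous.
Qed.

Lemma cts_snd i : continuous (fun p : X => p.2 0 i).
Proof.
move=> p; apply: (@continuous_comp _ _ _ snd (fun v : 'rV[R]_n => v 0 i)).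
  exact: cvg_snd.
exact: coord_continuous.
Qed.

Lemma cts_sqlen : continuous (fun p : X => (sqlen p.2 - 1) ^+ 2).
Proof.
apply: cts_sqr; apply: ctsB; last exact: ctsC.
by apply: cts_sum => i; apply: cts_sqr; exact: cts_snd.
Qed.
End Cts.

Lemma cts_csq (T : topologicalType) (g : T -> C) : ccts g -> continuous (fun x => csq (g x)).
Proof. by move=> [g1 g2]; apply: ctsD; exact: cts_sqr. Qed.

Lemma ccts_cvec m i : ccts (fun p : 'rV[R]_m * 'rV[R]_(3 + 3) => cvec p.2 0 i).
Proof.
by split; under eq_fun do rewrite mxE /=; exact: cts_snd.
Qed.

Lemma ccts_real (T : topologicalType) (g : T -> R) :
  continuous g -> ccts (fun x => rc (g x)).
Proof. by move=> cg; split => //=; exact: ctsC. Qed.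

Lemma ccts_sum (T : topologicalType) (F : 'I_3 -> T -> C) :
  (forall i, ccts (F i)) -> ccts (fun x => \sum_i F i x).
Proof.
move=> cF; suff : forall r : seq 'I_3, ccts (fun x => \sum_(i <- r) F i x) by apply.
elim => [|i r IH]; first by under eq_fun do rewrite big_nil; exact: cctsC.
by under eq_fun do rewrite big_cons; exact: cctsD.
Qed.

Variables (d : nat) (f : tpoly R).
Hypotheses (f_form : is_form d f).
Let fC := complexify f.

(** Avoidance for coordinate vectors, free of the representative chosen by [hcoord]; [dualv] does
    the same for the dual curve. *)
Definition avoidv (l : 'rV[R]_3) : Prop :=
  forall x, x != 0 -> dot l x = 0 -> evalf f x != 0.

Definition dualv (l : 'rV[R]_3) : Prop :=
  exists2 p : 'rV[C]_3, p != 0 &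
    evalf fC p = 0 /\ exists c, map_mx rc l = c *: gradient fC p.

(** Normalizing the tangency point brings it into a compact set; by homogeneity of the gradient the
    factor moves into [c]. *)
Lemma dualv_unit l : dualv l -> exists w, [/\ sqlen w = 1, evalf fC (cvec w) = 0 &
  exists c, map_mx rc l = c *: gradient fC (cvec w)].
Proof.
move=> [p p0 [F0 [c lc]]]; have [w [a [a0 wp w1]]] := unit_cvec p0.
have fCd := complexify_homog f_form; exists w; split => //.
  by rewrite wp (evalf_homog _ _ fCd) F0 mulr0.
exists (c / rc a ^+ d.-1); rewrite wp (gradient_homog _ _ fCd) scalerA.
by rewrite divfK// expf_neq0// fmorph_eq0.
Qed.

Lemma dotZr l a x : dot l (a *: x) = a * dot l x.
Proof. by rewrite /dot mulr_sumr; apply: eq_bigr => i _; rewrite mxE mulrCA. Qed.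

Lemma avoidv_open l0 : avoidv l0 -> \forall l \near l0, avoidv l.
Proof.
move=> al0.
(* The zeros of [phi] are the unit vectors of real curve points on the line. *)
pose phi (p : 'rV[R]_3 * 'rV[R]_3) :=
  evalf f p.2 ^+ 2 + dot p.1 p.2 ^+ 2 + (sqlen p.2 - 1) ^+ 2.
have [||c c0 H] := @tube_pos R _ 3 1 l0 phi.
- apply: ctsD; last exact: cts_sqlen; apply: ctsD; apply: cts_sqr.
    by apply: cts_evalf => i; exact: cts_snd.
  by apply: cts_sum => i; apply: ctsM; [exact: cts_fst | exact: cts_snd].
- move=> x _; apply: sum3_gt0; rewrite ?sqr_ge0//= => /eqP fx /eqP lx /eqP.
  rewrite sqrf_eq0 subr_eq0 => /eqP x1; move: fx lx; rewrite !sqrf_eq0 => /eqP fx /eqP lx.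
  by have := al0 x (unit_neq0 x1) lx; rewrite fx eqxx.
apply: filterS H => l H x x0 lx; apply/eqP => fx.
have [a a0 ax] := unit_scale x0.
have := H (a *: x) (unit_box ax); rewrite /phi /= ax subrr dotZr lx mulr0.
rewrite (evalf_homog _ _ f_form) fx mulr0 expr0n /= !addr0.
by apply/negP; rewrite -ltNge.
Qed.

(** Tangency is expressed by the vanishing of the 2 x 2 minors of the line and the gradient, a
    closed condition. The minors would also vanish for a zero gradient, which smoothness
    excludes. *)
Lemma dualv_closed l0 : smooth_curve f -> l0 != 0 -> ~ dualv l0 ->
  \forall l \near l0, ~ dualv l.
Proof.
move=> f_smooth l00 ndl0.
pose G a p := evalf (mderiv a fC) p.
pose phi (p : 'rV[R]_3 * 'rV[R]_(3 + 3)) :=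
  csq (evalf fC (cvec p.2))
  + (\sum_a \sum_b csq (G a (cvec p.2) * rc (p.1 0 b) - G b (cvec p.2) * rc (p.1 0 a)))
  + (sqlen p.2 - 1) ^+ 2.
have sum0 (q : 'rV[R]_3 * 'rV[R]_(3 + 3)) : 0 <= \sum_a \sum_b
    csq (G a (cvec q.2) * rc (q.1 0 b) - G b (cvec q.2) * rc (q.1 0 a)).
  by apply: sumr_ge0 => a _; apply: sumr_ge0 => b _; exact: csq_ge0.
have [||c c0 H] := @tube_pos R _ _ 1 l0 phi.
- apply: ctsD; last exact: cts_sqlen; apply: ctsD.
    by apply: cts_csq; apply: ccts_evalf => i; exact: ccts_cvec.
  apply: cts_sum => a; apply: cts_sum => b; apply: cts_csq.
  under eq_fun do rewrite -mulrN -rmorphN; apply: cctsD; apply: cctsM;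
    do ?[by apply: ccts_evalf => i; exact: ccts_cvec].
  + by apply: ccts_real; exact: cts_fst.
  + by apply: ccts_real; apply: ctsN; exact: cts_fst.
- move=> w _; apply: sum3_gt0; rewrite ?sqr_ge0 ?csq_ge0//=; first exact: (sum0 (l0, w)).
  move=> /csq_eq0 F0 /eqP s0 /eqP; rewrite sqrf_eq0 subr_eq0 => /eqP w1.
  have p0 := cvec_neq0 w1; apply: ndl0; exists (cvec w) => //; split => //.
  have G0 := f_smooth _ p0 F0.
  have /existsP[b lb] : [exists b, l0 0 b != 0].
    by apply: contraNT l00; rewrite negb_exists => /forallP h; apply/eqP/rowP => b;
      rewrite mxE; apply/eqP; have := h b; rewrite negbK.
  have cross a : G a (cvec w) * rc (l0 0 b) = G b (cvec w) * rc (l0 0 a).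
    move: s0; rewrite psumr_eq0 => [/allP/(_ a)|? _]; last first.
      by apply: sumr_ge0 => ? _; exact: csq_ge0.
    rewrite mem_index_enum => /(_ isT) /=.
    rewrite psumr_eq0 => [/allP/(_ b)|? _]; last exact: csq_ge0.
    by rewrite mem_index_enum => /(_ isT)/= /eqP/csq_eq0/eqP; rewrite subr_eq0 => /eqP.
  have lbC : rc (l0 0 b) != 0 by rewrite fmorph_eq0.
  have Gb : G b (cvec w) != 0.
    apply: contraNneq G0 => Gb; apply/eqP/rowP => a; rewrite !mxE.
    by apply: (mulIf lbC); rewrite mul0r [LHS]cross Gb mul0r.
  exists (rc (l0 0 b) / G b (cvec w)); apply/rowP => a; rewrite !mxE -/(G a (cvec w)).
  by rewrite mulrAC [rc _ * _]mulrC cross mulrAC divff// mul1r.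
apply: filterS H => l H /dualv_unit[w [w1 F0 [c' lc]]].
have := H w (unit_box w1); rewrite /phi /= w1 subrr F0 big1 => [|a _]; last first.
  rewrite big1// => b _; have lE e : rc (l 0 e) = c' * G e (cvec w).
    by move/rowP: lc => /(_ e); rewrite !mxE.
  rewrite !lE; move: (G a _) (G b _) => x y.
  rewrite mulrCA [y * _]mulrCA [y * x]mulrC subrr.
  by rewrite /csq /= expr0n addr0.
rewrite /csq /= !expr0n /= !addr0; apply/negP; by rewrite -ltNge.
Qed.
End Compactness.

(** * Tangent lines near an avoiding line *)

Lemma sum3_eq0 (R : realType) (a b c : R) : 0 <= a -> 0 <= b -> 0 <= c ->
  a + b + c = 0 -> [/\ a = 0, b = 0 & c = 0].
Proof. by move=> a0 b0 c0 abc; split; lra. Qed.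

Section LocalChart.
Variables (R : realType) (i j k : 'I_3).
Hypotheses (ij : i != j) (ik : i != k) (jk : j != k).
Local Notation C := (complex R).
Local Notation rc := (real_complex R).
Variables (d : nat) (f : tpoly R).
Hypotheses (f_form : is_form d f) (f_smooth : smooth_curve f).
Let fC := complexify f.

Definition line3 (t u : R) : 'rV[R]_3 := row3 i j 1 t u.

Lemma map_row3 (K L : pzRingType) (g : K -> L) a b c :
  map_mx g (row3 i j a b c) = row3 i j (g a) (g b) (g c).
Proof. by apply/rowP => m; rewrite !mxE; case: ifP => // _; case: ifP. Qed.

(** The expression is the imaginary part of p_k times the conjugate of p_j. If it vanished, p_j and
    p_k would be real up to a common factor, and then p_i as well by incidence, giving a real point
    of the curve on the line. *)
Lemma avoidv_chart t u (p : 'rV[C]_3) : avoidv f (line3 t u) -> p != 0 ->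
  evalf fC p = 0 -> p 0 i + rc t * p 0 j + rc u * p 0 k = 0 ->
  complex.Im (p 0 k) * complex.Re (p 0 j) - complex.Re (p 0 k) * complex.Im (p 0 j) != 0.
Proof.
move=> al p0 F0 lp; apply/negP => /eqP im0.
(* a real point of the line proportional to [p] would be a real point of the curve *)
have real_point a (x : 'rV[R]_3) : a != 0 -> a *: p = map_mx rc x -> False.
  move=> a0 px.
  have x0 : x != 0.
    apply: contraNneq p0 => x0; apply/eqP; apply: (scalerI a0).
    by rewrite px x0 scaler0; apply/rowP => m; rewrite !mxE.
  have lx : dot (line3 t u) x = 0.
    have E m : a * p 0 m = rc (x 0 m) by move/rowP: px => /(_ m); rewrite !mxE.
    have : a * (p 0 i + rc t * p 0 j + rc u * p 0 k) = 0 by rewrite lp mulr0.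
    rewrite !mulrDr !(mulrCA a) !E -!rmorphM -!rmorphD => -[lx].
    by rewrite /dot (sum3 ij ik jk) row3_i row3_j// row3_k// mul1r.
  have := evalf_complexify f x.
  rewrite -px (evalf_homog _ _ (complexify_homog f_form)) F0 mulr0 => /esym/eqP.
  by rewrite fmorph_eq0; apply/negP; exact: al.
have [pj0|pj0] := eqVneq (p 0 j) 0; last first.
  have [r pk] : exists r, p 0 k = rc r * p 0 j.
    move: pj0 im0; case: (p 0 k) => c e; case: (p 0 j) => a b ab0 /= im0.
    have n0 : a ^+ 2 + b ^+ 2 != 0.
      by apply: contraNneq ab0 => /(@csq_eq0 R (Complex a b)) ->.
    exists ((c * a + e * b) / (a ^+ 2 + b ^+ 2)).
    have {}im0 : e * a = c * b by apply/eqP; rewrite -subr_eq0; apply/eqP.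
    apply: complex_eqP; rewrite /= mul0r ?subr0 ?addr0; apply: (mulIf n0).
      rewrite [RHS]mulrAC divfK// mulrDl mulrDr [e * b * a]mulrAC im0; ring.
    rewrite [RHS]mulrAC divfK// mulrDl mulrDr mulrA im0 -[c * a * b]mulrAC; ring.
  apply: (@real_point (p 0 j)^-1 (row3 i j (- (t + u * r)) 1 r)).
    by rewrite invr_eq0.
  rewrite map_row3; apply: (row3_eq ij ik jk); rewrite rowZ.
  - rewrite -[LHS]subr0 -[X in _ - X](mulr0 (p 0 j)^-1) -lp pk.
    by rewrite !rmorphN rmorphD rmorphM /=; field.
  - by rewrite mulVf ?rmorph1.
  - by rewrite pk mulrC mulfK.
have pk0 : p 0 k != 0.
  apply: contraNneq p0 => pk0; apply/eqP.
  move: lp; rewrite pj0 pk0 !mulr0 !addr0 => pi0.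
  by rewrite (row3_eq ij ik jk pi0 pj0 pk0); apply/rowP => m; rewrite !mxE; do 2![case: ifP => //].
apply: (@real_point (p 0 k)^-1 (row3 i j (- u) 0 1)); first by rewrite invr_eq0.
rewrite map_row3; apply: (row3_eq ij ik jk); rewrite rowZ.
- move: lp; rewrite pj0 mulr0 addr0 => /eqP; rewrite addr_eq0 => /eqP ->.
  by rewrite rmorphN /=; field.
- by rewrite pj0 mulr0 rmorph0.
- by rewrite mulVf ?rmorph1.
Qed.

(** Two compactness arguments. [avoidv_chart] keeps p_j and the imaginary part of s = p_k / p_j away
    from 0 for all lines near the given one; smoothness then bounds the gradient, hence [l], from
    below on the points scaled to p_j = 1. *)
Lemma tangent_normal t0 u0 : avoidv f (line3 t0 u0) ->
  exists e B c c0 : R, [/\ 0 < e <= 1, 1 <= B, 0 < c, 0 < c0 &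
    forall t u, `|t - t0| < e -> `|u - u0| < e ->
      `|u| <= B /\ (dualv f (line3 t u) -> exists s z l,
        [/\ tangent_data i j fC t u s z l, normc s <= B, normc z <= B,
         c <= normc l & c0 <= `|complex.Im s|])].
Proof.
move=> al0.
pose im2 (p : 'rV[C]_3) :=
  complex.Im (p 0 k) * complex.Re (p 0 j) - complex.Re (p 0 k) * complex.Im (p 0 j).
(* The summand 0 gives [phi] the three-term shape of [sum3_gt0]; the inner sum is split by
   [sum3_eq0]. *)
pose phi (q : 'rV[R]_3 * 'rV[R]_(3 + 3)) :=
  (csq (evalf fC (cvec q.2)) + csq (\sum_m rc (q.1 0 m) * cvec q.2 0 m)
   + im2 (cvec q.2) ^+ 2) + 0 + (sqlen q.2 - 1) ^+ 2.
have [||c1 c10 H] := @tube_pos R _ _ 1 (line3 t0 u0) phi.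
- apply: ctsD; last exact: cts_sqlen; apply: ctsD; last exact: ctsC.
  apply: ctsD; first apply: ctsD.
  + by apply: cts_csq; apply: ccts_evalf => m; exact: ccts_cvec.
  + apply: cts_csq; apply: ccts_sum => m; apply: cctsM; last exact: ccts_cvec.
    by apply: ccts_real; exact: cts_fst.
  + have [Rk Ik] := @ccts_cvec R 3 k; have [Rj Ij] := @ccts_cvec R 3 j.
    by apply: cts_sqr; apply: ctsB; apply: ctsM.
- move=> w _; apply: sum3_gt0; rewrite ?sqr_ge0 ?addr_ge0 ?csq_ge0 ?sqr_ge0//=.
  case/(sum3_eq0 (csq_ge0 _) (csq_ge0 _) (sqr_ge0 _)) => /csq_eq0 F0 /csq_eq0 lp.
  move=> /eqP; rewrite sqrf_eq0 => im0 _ /eqP; rewrite sqrf_eq0 subr_eq0 => /eqP w1.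
  have := avoidv_chart al0 (cvec_neq0 w1) F0; rewrite -/(im2 _) im0 => /(_ _)/negP[]//.
  move: lp; rewrite (sum3 ij ik jk) /line3 row3_i row3_j// row3_k//.
  by rewrite rmorph1 mul1r.
have /nbhs_ballP[e' /= e'0 He] := H.
pose e := Num.min 1 e'.
(* [S] bounds s, whose squared modulus will be at most 4 / c1; [B] also covers t, u and z = - (t + u
   s). *)
pose S := 4 / c1 + 1; pose B := 1 + S + (`|t0| + 1) + (`|u0| + 1) * S.
have S1 : 1 <= S by rewrite lerDr divr_ge0// ltW.
have S0 : 0 <= S by apply: le_trans S1.
have nt0 : 0 <= `|t0| by [].
have nu0 : 0 <= (`|u0| + 1) * S by rewrite mulr_ge0// addr_ge0.
have SB : S <= B.
  by rewrite /B; move: nu0 nt0; lra.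
have B1 : 1 <= B := le_trans S1 SB.
(* [psi] is constant in its first argument: here [tube_pos] only expresses the compactness of the
   box. *)
pose psi (q : 'rV[R]_3 * 'rV[R]_(3 + 3)) :=
  csq (evalf fC (cvec q.2)) + \sum_m csq (evalf (mderiv m fC) (cvec q.2))
  + csq (cvec q.2 0 j - 1).
have [||c2 c20 /nbhs_singleton Hpsi] := @tube_pos R _ _ B (0 : 'rV[R]_3) psi.
- apply: ctsD; first apply: ctsD.
  + by apply: cts_csq; apply: ccts_evalf => m; exact: ccts_cvec.
  + apply: cts_sum => m; apply: cts_csq; apply: ccts_evalf => q; exact: ccts_cvec.
  + by apply: cts_csq; apply: cctsD; [exact: ccts_cvec | exact: cctsC].
- move=> w _; apply: sum3_gt0; rewrite ?csq_ge0//=.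
    by apply: sumr_ge0 => m _; exact: csq_ge0.
  move=> /csq_eq0 F0 /eqP; rewrite psumr_eq0 => [/allP G0|m _]; last exact: csq_ge0.
  move=> /csq_eq0/eqP; rewrite subr_eq0 => /eqP wj.
  have w0 : cvec w != 0.
    by apply/eqP => /rowP/(_ j)/eqP; rewrite wj mxE oner_eq0.
  move: (f_smooth w0 F0); apply/negP; rewrite negbK; apply/eqP/rowP => m.
  have := G0 m; rewrite mem_index_enum => /(_ isT)/= /eqP/csq_eq0.
  by rewrite !mxE.
pose M := 1 + B ^+ 2 + B ^+ 2.
have M0 : 0 < M by rewrite /M -addrA ltr_wpDr// addr_ge0// sqr_ge0.
exists e, B, (Num.min 1 (c2 / M)), (Num.min 1 (c1 / 4)); split => //.
- by rewrite /e lt_min ltr01 e'0 /= ge_min lexx.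
- by rewrite lt_min ltr01 divr_gt0.
- by rewrite lt_min ltr01 divr_gt0.
move=> t u; rewrite !lt_min => /andP[t1 te] /andP[u1 ue].
have tB : `|t| <= `|t0| + 1.
  by rewrite -[t](subrK t0) (le_trans (ler_normD _ _))// addrC lerD2l ltW.
have uB : `|u| <= `|u0| + 1.
  by rewrite -[u](subrK u0) (le_trans (ler_normD _ _))// addrC lerD2l ltW.
have tB' : `|t| <= B.
  by apply: le_trans tB _; rewrite /B; move: nu0 S0; lra.
have uB' : `|u| <= B.
  apply: le_trans uB _; apply: (@le_trans _ _ ((`|u0| + 1) * S)).
    by rewrite ler_peMr// addr_ge0.
  by rewrite /B; move: nt0 S0; lra.
split=> // /(dualv_unit f_form)[w [w1 F0 [c' lc]]].
have near_l : ball (line3 t0 u0) e' (line3 t u).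
  split=> // a b; rewrite /line3 (ord1 a); have [->|->|->] := ord3_cases ij ik jk b.
  - by rewrite !row3_i; exact: ballxx.
  - by rewrite !row3_j// -ball_normE /= distrC.
  - by rewrite !row3_k// -ball_normE /= distrC.
have := He _ near_l w (unit_box w1); rewrite /phi /= w1 subrr F0.
set p := cvec w in F0 lc *.
have c'0 : c' != 0.
  apply/eqP => c'0; move/rowP: lc => /(_ i); rewrite c'0 scale0r !mxE eqxx.
  by move=> /eqP; rewrite fmorph_eq0 oner_eq0.
have Gp : gradient fC p = c'^-1 *: row3 i j 1 (rc t) (rc u).
  by rewrite -(rmorph1 rc) -map_row3 lc scalerA mulVf// scale1r.
have lp : p 0 i + rc t * p 0 j + rc u * p 0 k = 0.
  have := euler_form p (complexify_homog f_form); rewrite -/fC F0 mul0rn Gp.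
  rewrite (sum3 ij ik jk) !rowZ row3_i row3_j// row3_k// => e0.
  by apply: (mulfI (invr_neq0 c'0)); rewrite mulr0 -e0; ring.
rewrite (sum3 ij ik jk) {1 2 3}/line3 row3_i row3_j// row3_k// rmorph1 mul1r lp.
rewrite {1 2}/csq /= !expr0n /= !addr0 add0r => c1im.
have csq2 m : csq (p 0 m) <= 2.
  rewrite mxE /csq /= (_ : 2 = 1 + 1)// -w1.
  by apply: lerD; exact: coord_le_sqlen.
(* The modulus of p_k times the conjugate of p_j, squared; it bounds p_j away from 0, as p_k is
   bounded. *)
have csq_kj : csq (p 0 k) * csq (p 0 j) = im2 p ^+ 2
    + (complex.Re (p 0 k) * complex.Re (p 0 j)
       + complex.Im (p 0 k) * complex.Im (p 0 j)) ^+ 2.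
  rewrite /im2 /csq; case: (p 0 k) => x y; case: (p 0 j) => x' y' /=; ring.
have c1kj : c1 <= csq (p 0 k) * csq (p 0 j).
  by rewrite csq_kj; apply: le_trans c1im _; rewrite lerDl sqr_ge0.
have csqj : c1 / 2 <= csq (p 0 j).
  rewrite ler_pdivrMr// mulrC; apply: le_trans c1kj _.
  by rewrite ler_wpM2r ?csq_ge0.
have csqj0 : 0 < csq (p 0 j) by apply: lt_le_trans csqj; rewrite divr_gt0.
have pj0 : p 0 j != 0.
  by apply/eqP => pj0; move: csqj0; rewrite pj0 /csq /= expr0n addr0 ltxx.
pose s := p 0 k / p 0 j; pose z := p 0 i / p 0 j.
have sj : s * p 0 j = p 0 k by rewrite divfK.
have csqs : csq s * csq (p 0 j) = csq (p 0 k) by rewrite -csqM sj.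
have ims : complex.Im s * csq (p 0 j) = im2 p.
  have E (x y : C) : complex.Im x * csq y =
      complex.Im (x * y) * complex.Re y - complex.Re (x * y) * complex.Im y.
    by case: x => ? ?; case: y => ? ?; rewrite /csq /=; ring.
  by rewrite E sj.
have csqs4 : csq s <= 4 / c1.
  rewrite ler_pdivlMr//; have : csq s * (c1 / 2) <= 2.
    by apply: le_trans (csq2 k); rewrite -csqs ler_wpM2l ?csq_ge0.
  by move: (csq s) => x; lra.
have sS : normc s <= S.
  rewrite leNgt; apply/negP => Ss; move: csqs4; apply/negP; rewrite -ltNge csqE.
  apply: (@lt_le_trans _ _ S); first by rewrite ltrDl.
  apply: le_trans (ltW Ss) _; rewrite expr2 ler_peMr ?normc_ge0//.
  exact: le_trans S1 (ltW Ss).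
have imsq : c1 / 4 <= complex.Im s ^+ 2.
  rewrite ler_pdivrMr//; apply: le_trans c1im _; rewrite -ims exprMn.
  rewrite ler_wpM2l ?sqr_ge0// expr2 (_ : 4 = 2 * 2); last by ring.
  by rewrite ler_pM ?csq_ge0.
have pinv : (p 0 j)^-1 *: p = row3 i j z 1 s.
  by apply: (row3_eq ij ik jk); rewrite rowZ ?mulVf// mulrC.
have zts : z + rc t + rc u * s = 0.
  by rewrite -[RHS](mulr0 (p 0 j)^-1) -lp /z /s; field.
have zB : normc z <= B.
  have -> : z = - (rc t + rc u * s) by apply/eqP; rewrite -addr_eq0 addrA zts.
  rewrite normc_opp; apply: le_trans (normcD _ _) _; rewrite normcM !normc_real.
  apply: (@le_trans _ _ (`|t0| + 1 + (`|u0| + 1) * S)).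
    by apply: lerD => //; apply: ler_pM => //; exact: normc_ge0.
  by rewrite /B; lra.
have sB : normc s <= B := le_trans sS SB.
pose l := (p 0 j)^-1 ^+ d.-1 * c'^-1.
have Gl : gradient fC (row3 i j z 1 s) = l *: row3 i j 1 (rc t) (rc u).
  by rewrite -pinv (gradient_homog _ _ (complexify_homog f_form)) Gp scalerA.
have F1 : evalf fC (row3 i j z 1 s) = 0.
  by rewrite -pinv (evalf_homog _ _ (complexify_homog f_form)) F0 mulr0.
exists s, z, l; split => //.
- have [|w' w'p w'B] := @cvec_onto_box R (row3 i j z 1 s) B.
    move=> m; have [->|->|->] := ord3_cases ij ik jk m.
    + by rewrite row3_i.
    + by rewrite row3_j// normc1.
    + by rewrite row3_k.
  have := Hpsi w' w'B; rewrite /psi /= w'p F1 row3_j// subrr (sum3 ij ik jk).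
  have Gm m : evalf (mderiv m fC) (row3 i j z 1 s) = l * row3 i j 1 (rc t) (rc u) 0 m.
    by move/rowP: Gl => /(_ m); rewrite mxE rowZ.
  rewrite !Gm row3_i row3_j// row3_k// !(csqM l).
  have csq_real (x : R) : csq (rc x) = x ^+ 2 by rewrite /csq /= expr0n addr0.
  have -> : csq (0 : C) = 0 by rewrite -(rmorph0 rc) csq_real expr0n.
  rewrite -(rmorph1 rc) !csq_real expr1n addr0 add0r mulr1 => c2l.
  have {}c2l : c2 <= csq l * M.
    apply: (@le_trans _ _ (csq l * (1 + t ^+ 2 + u ^+ 2))).
      by apply: le_trans c2l _; rewrite le_eqVlt; apply/orP; left; apply/eqP; ring.
    have sq x : `|x| <= B -> x ^+ 2 <= B ^+ 2.
      by move=> xB; rewrite -[x ^+ 2]real_normK ?num_real// ler_pXn2r// nnegrE (le_trans ler01).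
    by rewrite ler_wpM2l ?csq_ge0// /M; apply: lerD; [apply: lerD|]; rewrite ?sq.
  rewrite leNgt; apply/negP; rewrite lt_min => /andP[l1].
  apply/negP; rewrite -leNgt ler_pdivrMr//; apply: le_trans c2l _.
  by rewrite ler_wpM2r ?(ltW M0)// csqE expr2 ler_piMr ?normc_ge0// ltW.
- rewrite leNgt; apply/negP; rewrite lt_min => /andP[l1].
  apply/negP; rewrite -leNgt; apply: le_trans imsq _.
  by rewrite -real_normK ?num_real// expr2 ler_piMr// ltW.
Qed.

(** If every t of the interval had a tangent line with u near [u0], a choice of tangency points
    would be a function s(t) satisfying [pair_cubic], against [no_cubic_family]. *)
Lemma dual_gap t0 u0 : avoidv f (line3 t0 u0) ->
  exists2 e, 0 < e & forall a b, t0 - e < a -> a < b -> b < t0 + e ->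
    exists2 t, a < t < b & forall u, `|u - u0| < e -> ~ dualv f (line3 t u).
Proof.
move=> al0; have [e1 [B [c [c0 [/andP[e10 e11] B1 cp c0p HN]]]]] := tangent_normal al0.
have [K [rho [K0 [rho0 HK]]]] := pair_cubic ij ik jk fC B1 cp c0p.
have B0 : 0 < B by apply: lt_le_trans B1.
(* With t, u and s varying by at most [r], incidence lets z vary by at most r + 2 r B <= rho. The
   window [e] is at most r / 2 because two of its points may lie on opposite sides of the centre. *)
pose r := rho / (2 * (1 + B)).
have r0 : 0 < r by rewrite divr_gt0// mulr_gt0// ltr_wpDl// ltW.
have rB : 2 * (r + r * B) = rho by rewrite /r; field; rewrite gt_eqF// ltr_wpDl// ltW.
pose e := Num.min e1 (r / 2).
have e0 : 0 < e by rewrite lt_min e10 divr_gt0.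
have ee1 : e <= e1 by rewrite ge_min lexx.
have er : e <= r / 2 by rewrite ge_min lexx orbT.
exists e => // a b ta ab bt; apply: contrapT => none.
have fam t : exists s : C, a < t < b -> exists u z l, [/\ `|u - u0| < e,
    tangent_data i j fC t u s z l, normc s <= B /\ normc z <= B,
    c <= normc l & c0 <= `|complex.Im s| /\ `|u| <= B].
  have [tab|] := boolP (a < t < b); last by exists 0.
  have [u [uu0 du]] : exists u, `|u - u0| < e /\ dualv f (line3 t u).
    apply: contrapT => nu; apply: none; exists t => // u uu0 du.
    by apply: nu; exists u.
  have tt0 : `|t - t0| < e by rewrite ltr_norml; move: tab => /andP[? ?]; lra.
  have [uB /(_ du)[s [z [l [? ? ? ? ?]]]]] := HN t u (lt_le_trans tt0 ee1) (lt_le_trans uu0 ee1).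
  by exists s => _; exists u, z, l.
have [s Hs] := choice fam.
apply: (@no_cubic_family R a b B K (Num.min rho r) s) => //.
- by rewrite lt_min rho0.
- by move=> t /Hs[u [z [l [_ _ []]]]].
- move=> t t' tab tab'; rewrite le_min => /andP[hrho hr].
  have [u [z [l [uu T [sB zB] cl [Is uB]]]]] := Hs t tab.
  have [u' [z' [l' [uu' T' [sB' zB'] cl' [Is' uB']]]]] := Hs t' tab'.
  apply: (HK _ _ _ _ _ _ _ _ _ _ T T') => //.
  have -> : z' - z = - (rc (t' - t) + rc (u' - u) * s t' + rc u * (s t' - s t)).
    case: T => _ _ E1; case: T' => _ _ E2.
    by rewrite -[LHS]addr0 -[X in _ + X](subrr 0) -{1}E1 -E2 !rmorphB /=; ring.
  rewrite normc_opp; apply: le_trans (normcD _ _) _; rewrite -rB.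
  have tr : `|t' - t| <= r.
    by rewrite ler_norml; move: tab tab' => /andP[? ?] /andP[? ?]; lra.
  have ur : `|u' - u| <= r.
    move: uu uu'; rewrite !ltr_norml ler_norml => /andP[? ?] /andP[? ?]; lra.
  have h1 : normc (rc (t' - t)) <= r by rewrite normc_real.
  have h2 : normc (rc (u' - u) * s t') <= r * B.
    by rewrite normcM normc_real ler_pM// normc_ge0.
  have h3 : normc (rc u * (s t' - s t)) <= r * B.
    by rewrite normcM normc_real mulrC ler_pM// normc_ge0.
  have := normcD (rc (t' - t)) (rc (u' - u) * s t'); lra.
Qed.
End LocalChart.

(** * The projective plane *)

Section Plane.
Variable R : realType.
Local Notation RP := (RP2 R).

Definition mknz (v : 'rV[R]_3) (v0 : v != 0) : nzvec R :=
  exist (fun x => x \in [set v : 'rV[R]_3 | v != 0]) v (mem_set v0).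

Lemma const1_neq0 : (const_mx 1 : 'rV[R]_3) != 0.
Proof. by apply/eqP => /rowP/(_ ord0)/eqP; rewrite !mxE oner_eq0. Qed.

(* The value at the zero vector is junk. *)
Definition toP (v : 'rV[R]_3) : RP := \pi_RP (insubd (mknz const1_neq0) v).

Lemma val_nzvec (v : 'rV[R]_3) : v != 0 -> exists x : nzvec R, val x = v.
Proof. by move=> v0; exists (mknz v0). Qed.

Lemma toP_val (x : nzvec R) : toP (val x) = \pi_RP x.
Proof. by rewrite /toP valKd. Qed.

Lemma val_neq0 (x : nzvec R) : val x != 0.
Proof. exact: (set_mem (valP x)). Qed.

Lemma hcoord_neq0 (x : RP) : hcoord x != 0.
Proof. exact: val_neq0. Qed.

Lemma toP_hcoord (x : RP) : toP (hcoord x) = x.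
Proof. by rewrite toP_val reprK. Qed.

Lemma toP_eq (v w : 'rV[R]_3) : v != 0 -> w != 0 ->
  toP v = toP w <-> exists2 c, c != 0 & w = c *: v.
Proof.
move=> /val_nzvec[x <-] /val_nzvec[y <-]; rewrite !toP_val.
have E : (\pi_({eq_quot (proportional_equiv R)}) x
  = \pi_({eq_quot (proportional_equiv R)}) y) <-> proportional x y.
  by split => [/eqmodP|/eqmodP].
apply: (iff_trans E); split; first by move=> /asboolP.
by move=> h; apply/asboolP.
Qed.

Lemma hcoord_toP (v : 'rV[R]_3) : v != 0 -> exists2 c, c != 0 & hcoord (toP v) = c *: v.
Proof.
move=> v0; apply/(toP_eq v0); first exact: hcoord_neq0.
by rewrite toP_hcoord.
Qed.

Lemma toPZ c (v : 'rV[R]_3) : v != 0 -> c != 0 -> toP (c *: v) = toP v.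
Proof.
by move=> v0 c0; apply/esym/toP_eq; rewrite ?scaler_eq0 ?negb_or ?c0//; exists c.
Qed.

Lemma near_neq0 (v : 'rV[R]_3) : v != 0 -> \forall w \near v, w != 0.
Proof.
move=> v0; have /existsP[i vi] : [exists i, v 0 i != 0].
  apply: contraNT v0; rewrite negb_exists => /forallP h.
  by apply/eqP/rowP => m; rewrite mxE; apply/eqP; have := h m; rewrite negbK.
have : \forall w \near v, (w : 'rV[R]_3) 0 i != 0.
  have N : nbhs (v 0 i) [set x : R | x != 0].
    by apply: open_nbhs_nbhs; split => //; exact: open_neq.
  exact: (@coord_continuous R 1 3 0 i v _ N).
by apply: filterS => w; apply: contraNneq => ->; rewrite mxE.
Qed.

Lemma open_nzvec (O : set (nzvec R)) : open O ->
  exists2 B : set 'rV[R]_3, open B & val @^-1` B = O.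
Proof. by move=> oO; exact: oO. Qed.

(** With [open_toP], this reduces the quotient of a subspace topology to neighbourhoods of nonzero
    vectors in R^3. *)
Lemma near_toP (O : set RP) (v : 'rV[R]_3) : open O -> v != 0 -> O (toP v) ->
  \forall w \near v, O (toP w).
Proof.
move=> oO v0 Ov; have [B oB BO] : exists2 B : set 'rV[R]_3, open B &
    val @^-1` B = \pi_RP @^-1` O :> set (nzvec R) by exact: open_nzvec.
have E (w : 'rV[R]_3) : w != 0 -> B w = O (toP w).
  move=> /val_nzvec[x <-]; rewrite toP_val.
  by have := congr1 (fun S : set (nzvec R) => S x) BO.
have : \forall w \near v, B w by apply: open_nbhs_nbhs; split => //; rewrite E.
by apply: filterS2 (near_neq0 v0) => w w0; rewrite E.
Qed.

Lemma open_toP (O : set RP) :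
  (forall v, v != 0 -> O (toP v) -> \forall w \near v, O (toP w)) -> open O.
Proof.
move=> H; rewrite /open/= /quotient_open.
suff -> : \pi_RP @^-1` O = val @^-1` (interior [set w | O (toP w)]) :> set (nzvec R).
  by exists (interior [set w | O (toP w)]) => //; exact: open_interior.
apply/seteqP; split => x /=; rewrite -toP_val.
  by move=> Ox; apply: H => //; exact: val_neq0.
exact: nbhs_singleton.
Qed.

Lemma toP_continuous (T : topologicalType) (g : T -> 'rV[R]_3) x :
  g x != 0 -> {for x, continuous g} -> {for x, continuous (toP \o g)}.
Proof.
move=> gx0 cg B; rewrite nbhsE /= => -[V [Vo Vx] VB].
have H := cg _ (near_toP Vo gx0 Vx).
exact: (@filterS _ (nbhs x) _ _ _ (fun y => VB (toP (g y))) H).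
Qed.

Variables (d : nat) (f : tpoly R).
Hypotheses (f_form : is_form d f).

Lemma dotZl c (u v : 'rV[R]_3) : dot (c *: u) v = c * dot u v.
Proof. by rewrite /dot mulr_sumr; apply: eq_bigr => i _; rewrite mxE mulrA. Qed.

Lemma avoidance_toP v : v != 0 -> avoidance_locus f (toP v) <-> avoidv f v.
Proof.
move=> v0; have [c c0 vE] := hcoord_toP v0; split => [av x x0 vx|av x fx].
  have [c' c'0 xE] := hcoord_toP x0; apply/eqP => fx; apply: (av (toP x)).
    by rewrite /real_points /= xE (evalf_homog _ _ f_form) fx mulr0.
  have -> : on_line (toP v) (toP x) = (dot (hcoord (toP v)) (hcoord (toP x)) = 0) by [].
  by rewrite vE xE dotZl dotZr vx !mulr0.
rewrite /on_line -/(dot _ _) vE dotZl => /eqP; rewrite mulf_eq0 (negPf c0) => /eqP lx.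
by have := av _ (hcoord_neq0 x) lx; rewrite fx eqxx.
Qed.

Lemma dual_toP v : v != 0 -> real_dual_curve f (toP v) <-> dualv f v.
Proof.
move=> v0; have [c c0 vE] := hcoord_toP v0.
have cC : real_complex R c != 0 by rewrite fmorph_eq0.
split => -[p p0 [F0 [c' lc]]]; exists p => //; split => //.
  exists ((real_complex R c)^-1 * c'); rewrite -scalerA -lc vE map_mxZ scalerA.
  by rewrite mulVf ?scale1r.
by exists (real_complex R c * c'); rewrite vE map_mxZ lc scalerA.
Qed.

Hypotheses (f_smooth : smooth_curve f).

Lemma avoidance_open : open (avoidance_locus f).
Proof.
apply: open_toP => v v0 /(avoidance_toP v0)/(avoidv_open f_form).
by apply: filterS2 (near_neq0 v0) => w w0 /(avoidance_toP w0).
Qed.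

Lemma dual_closed : open (~` real_dual_curve f).
Proof.
apply: open_toP => v v0 /= nv.
have : \forall w \near v, ~ dualv f w.
  by apply: (dualv_closed f_form) => // /(dual_toP v0).
by apply: filterS2 (near_neq0 v0) => w w0 nw /(dual_toP w0).
Qed.

(** * Signs of the form on a real line *)

Definition signv (l : 'rV[R]_3) : Prop := exists x y,
  [/\ dot l x = 0, dot l y = 0, evalf f x < 0 & 0 < evalf f y].

Lemma signv_open l0 : l0 != 0 -> signv l0 -> \forall l \near l0, signv l.
Proof.
move=> l00 [x [y [lx ly fx fy]]].
(* Projection to the plane orthogonal to [l], without division: it carries the witnesses to nearby
   lines, and at [l0] only multiplies them by [dot l0 l0]. *)
pose pr z (l : 'rV[R]_3) := dot l l *: z - dot l z *: l.
have cdot z : continuous (fun l : 'rV[R]_3 => dot l z).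
  apply: cts_sum => i; apply: ctsM; last exact: ctsC.
  by move=> l; exact: coord_continuous.
have cdotl : continuous (fun l : 'rV[R]_3 => dot l l).
  by apply: cts_sum => i; apply: ctsM => l; exact: coord_continuous.
have prE z l : dot l (pr z l) = 0.
  rewrite /pr -scaleNr.
  have dotD (u v : 'rV[R]_3) : dot l (u + v) = dot l u + dot l v.
    by rewrite /dot -big_split; apply: eq_bigr => i _; rewrite mxE mulrDr.
  by rewrite dotD !dotZr mulrC mulNr subrr.
have cpr z : continuous (fun l => evalf f (pr z l)).
  apply: cts_evalf => i; rewrite /pr.
  under eq_fun do rewrite !mxE.
  apply: ctsB; apply: ctsM => //; first exact: ctsC.
  by move=> l; exact: coord_continuous.
have ll0 : 0 < dot l0 l0 ^+ d.
  by apply: exprn_gt0; rewrite /dot; under eq_bigr do rewrite -expr2; exact: sqlen_gt0.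
have fpr z : dot l0 z = 0 -> evalf f (pr z l0) = dot l0 l0 ^+ d * evalf f z.
  by move=> lz; rewrite /pr lz scale0r subr0 (evalf_homog _ _ f_form).
have Hx : \forall l \near l0, evalf f (pr x l) < 0.
  have h : evalf f (pr x l0) < 0 by rewrite fpr// pmulr_rlt0.
  exact: (cpr x l0 _ (lt_nbhsl h)).
have Hy : \forall l \near l0, 0 < evalf f (pr y l).
  have h : 0 < evalf f (pr y l0) by rewrite fpr// pmulr_rgt0.
  exact: (cpr y l0 _ (lt_nbhsr h)).
by apply: filterS2 Hx Hy => l hx hy; exists (pr x l), (pr y l).
Qed.

Hypothesis d_even : ~~ odd d.

Lemma dotDr (l u v : 'rV[R]_3) : dot l (u + v) = dot l u + dot l v.
Proof. by rewrite /dot -big_split; apply: eq_bigr => i _; rewrite mxE mulrDr. Qed.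

Lemma dotC (u v : 'rV[R]_3) : dot u v = dot v u.
Proof. by apply: eq_bigr => i _; rewrite mulrC. Qed.

Lemma dot_gt0 (v : 'rV[R]_3) : v != 0 -> 0 < dot v v.
Proof. by move=> /sqlen_gt0; rewrite /sqlen; under eq_bigr do rewrite expr2. Qed.

Lemma signv_not_avoid l : signv l -> ~ avoidv f l.
Proof.
move=> [x [y [lx ly fx fy]]] al.
pose g (t : R) := evalf f (x + t *: (y - x)).
have cg : continuous g.
  apply: cts_evalf => i; under eq_fun do rewrite !mxE.
  apply: ctsD; first exact: ctsC.
  by apply: ctsM; [move=> t; exact: cvg_id | exact: ctsC].
have g0 : g 0 = evalf f x by rewrite /g scale0r addr0.
have g1 : g 1 = evalf f y by rewrite /g scale1r addrC subrK.
have [||c _ gc] := @IVT R g 0 1 0 ler01.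
- exact: continuous_subspaceT.
- by rewrite g0 g1 ge_min le_max (ltW fx) (ltW fy) orbT.
have lc : dot l (x + c *: (y - x)) = 0.
  by rewrite dotDr dotZr dotDr -scaleN1r dotZr lx ly !mulr0 addr0 mulr0 addr0.
(* The intermediate value may be attained at the zero vector, which is no point. Then [y] is a
   multiple of [x], and evenness of [d] forbids opposite signs. *)
have [z0|z0] := eqVneq (x + c *: (y - x)) 0; last first.
  by have := al _ z0 lc; rewrite -/(g c) gc eqxx.
have [c0|c0] := eqVneq c 0.
  by move: gc; rewrite c0 g0 => fx0; rewrite fx0 ltxx in fx.
have yE : y = (c^-1 * (c - 1)) *: x.
  apply: (scalerI c0); rewrite scalerA mulVKf//.
  apply/eqP; rewrite -subr_eq0 -z0; apply/eqP.
  by rewrite scalerBr scalerBl scale1r opprB addrCA addrA.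
move: fy; rewrite yE (evalf_homog _ _ f_form) ltNge => /negP; apply.
by rewrite mulr_ge0_le0 ?exprn_even_ge0// ltW.
Qed.

Lemma horner_continuous (Q : {poly R}) : continuous (fun t => Q.[t]).
Proof.
under eq_fun do rewrite horner_coef.
apply: cts_sum => i; apply: ctsM; first exact: ctsC.
elim: (i : nat) => [|n IH]; first by under eq_fun do rewrite expr0; exact: ctsC.
by under eq_fun do rewrite exprS; apply: ctsM => // t; exact: cvg_id.
Qed.

(** Near 0 the cofactor of X keeps the sign of its value at 0, which is the derivative. *)
Lemma sign_change (Q : {poly R}) : Q.[0] = 0 -> 0 < Q^`().[0] ->
  exists t, Q.[- t] < 0 /\ 0 < Q.[t].
Proof.
move=> /eqP/factor_theorem[P ->]; rewrite subr0 derivM derivX mulr1.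
rewrite hornerD hornerM hornerX mulr0 add0r => P0.
have : \forall t \near (0 : R), 0 < P.[t].
  exact: (@horner_continuous P 0 _ (lt_nbhsr P0)).
move=> /nbhs_ballP[e /= e0 He]; exists (e / 2).
have He2 t : `|t| < e -> 0 < P.[t].
  by move=> te; apply: He; rewrite -ball_normE /= sub0r normrN.
have ee : `|e / 2| < e.
  by rewrite gtr0_norm ?divr_gt0// ltr_pdivrMr// ltr_pMr// ltr1n.
rewrite !hornerM !hornerX mulrN oppr_lt0; split; apply: mulr_gt0; rewrite ?divr_gt0//.
  by apply: He2; rewrite normrN.
exact: He2.
Qed.

(** At a real point [x] common to line and curve, let [m] be the gradient projected into the line,
    up to a positive factor. It is nonzero, since the gradient is nonzero by smoothness and not
    proportional to the line. The derivative of f along [m] is positive, so f changes sign at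
    [x]. *)
Lemma not_avoid_signv l : l != 0 -> ~ avoidv f l -> ~ dualv f l -> signv l.
Proof.
move=> l0 nal ndl.
have [x [x0 lx fx]] : exists x, [/\ x != 0, dot l x = 0 & evalf f x = 0].
  apply: contrapT => nx; apply: nal => x x0 lx; apply/eqP => fx.
  by apply: nx; exists x.
pose G := gradient f x; pose m := dot l l *: G - dot l G *: l.
have ll := dot_gt0 l0.
have lm : dot l m = 0.
  by rewrite /m -scaleNr dotDr !dotZr mulrC mulNr subrr.
have xC : map_mx (real_complex R) x != 0.
  apply: contraNneq x0 => /rowP xC; apply/eqP/rowP => i.
  by have := xC i; rewrite !mxE => /eqP; rewrite fmorph_eq0 => /eqP.
have FC : evalf (complexify f) (map_mx (real_complex R) x) = 0.
  by rewrite evalf_complexify fx rmorph0.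
have G0 : G != 0.
  have := f_smooth xC FC; rewrite gradient_complexify; apply: contraNneq => G0.
  by rewrite -/G G0 map_mx0.
have m0 : m != 0.
  apply/eqP => m0; have lG : dot l l *: G = dot l G *: l by apply/eqP; rewrite -subr_eq0 -/m m0.
  have lG0 : dot l G != 0.
    apply: contraNneq G0 => e; apply/eqP; apply: (scalerI (lt0r_neq0 ll)).
    by rewrite lG e scale0r scaler0.
  apply: ndl; exists (map_mx (real_complex R) x) => //; split => //.
  exists (real_complex R (dot l l / dot l G)).
  rewrite gradient_complexify -map_mxZ; congr map_mx.
  by rewrite mulrC -scalerA -/G lG scalerA mulVf// scale1r.
have mG : 0 < dot m G.
  rewrite -(pmulr_rgt0 _ ll) -dotZr.
  have -> : dot l l *: G = m + dot l G *: l by rewrite /m subrK.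
  by rewrite dotDr dotZr (dotC m l) lm mulr0 addr0 dot_gt0.
have [||t [nt pt]] := @sign_change (line_poly f x m).
- by rewrite horner_line_poly scale0r addr0.
- by rewrite horner_deriv_line_poly scale0r addr0.
have lt c : dot l (x + c *: m) = 0 by rewrite dotDr dotZr lx lm mulr0 addr0.
exists (x + (- t) *: m), (x + t *: m).
by split; rewrite ?lt// -horner_line_poly.
Qed.

(* Off the dual curve, avoiding lines are those on which [f] does not change sign,
   so avoidance is both an open and a closed condition there. *)
Lemma connected_avoidance (S : set RP) x : connected S -> S `<=` ~` real_dual_curve f ->
  S x -> avoidance_locus f x -> S `<=` avoidance_locus f.
Proof.
move=> cS SD Sx Ax.
pose W : set RP := [set l | signv (hcoord l)].
have WtoP v : v != 0 -> W (toP v) <-> signv v.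
  move=> v0; have [c c0 vE] := hcoord_toP v0; rewrite /W /= vE.
  split => -[y [z [ly lz fy fz]]]; exists y, z; split => //; rewrite ?dotZl ?ly ?lz ?mulr0//.
    by move/eqP: ly; rewrite dotZl mulf_eq0 (negPf c0) => /eqP.
  by move/eqP: lz; rewrite dotZl mulf_eq0 (negPf c0) => /eqP.
have oW : open W.
  apply: open_toP => v v0 /(WtoP _ v0)/(signv_open v0).
  by apply: filterS2 (near_neq0 v0) => w w0 /(WtoP _ w0).
have AW y : S y -> avoidance_locus f y <-> ~ W y.
  move=> /SD; rewrite -(toP_hcoord y); have y0 := hcoord_neq0 y.
  move=> nD; split => [/(avoidance_toP y0) ay /(WtoP _ y0)|nW].
    by move=> /signv_not_avoid.
  apply/(avoidance_toP y0); apply: contrapT => na; apply: nW.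
  by apply/(WtoP _ y0); apply: not_avoid_signv => // /(dual_toP y0).
suff <- : S `&` avoidance_locus f = S by exact: subIsetr.
apply: cS.
- by exists x.
- by exists (avoidance_locus f) => //; exact: avoidance_open.
- exists (~` W); first exact: open_closedC.
  by apply/seteqP; split => y [Sy Hy]; split => //; apply/(AW y Sy).
Qed.
End Plane.

(** * Local connectivity off the dual curve *)

Section Segments.
Variable R : realType.
Local Notation RP := (RP2 R).

Lemma affine_continuous (v m : 'rV[R]_3) : continuous (fun t : R => v + t *: m).
Proof. by move=> t; apply: cvgD; [exact: cvg_cst | apply: cvgZr_tmp; exact: cvg_id]. Qed.

Lemma affine_component (v m : 'rV[R]_3) (X : set RP) (a b : R) :
  (forall t, Num.min a b <= t <= Num.max a b ->
    v + t *: m != 0 /\ X (toP (v + t *: m))) ->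
  connected_component X (toP (v + a *: m)) (toP (v + b *: m)).
Proof.
wlog ab : a b / a <= b => [H|].
  case: (leP a b) => [|/ltW] ab h; first by apply: H => // t; rewrite min_l ?max_r//; exact: h.
  by apply/connected_component_sym/H => // t; rewrite min_l ?max_r//; exact: h.
rewrite min_l// max_r// => h.
pose g t := toP (v + t *: m).
apply: (@connected_component_max _ X (g @` `[a, b]) (g a)).
- by exists a => //=; rewrite in_itv /= lexx.
- by move=> y [t /=]; rewrite in_itv /= => /h[_ Xt] <-.
- apply: connected_continuous_connected; first exact: segment_connected.
  apply: continuous_in_subspaceT => t; rewrite inE /= in_itv /= => /h[t0 _].
  by apply: (@toP_continuous R R (fun t => v + t *: m)) => //; exact: affine_continuous.
- by exists b => //=; rewrite in_itv /= lexx andbT.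
Qed.

Lemma other_indices (i : 'I_3) : exists j k, [/\ i != j, i != k & j != k].
Proof.
have H a b c : (a < 3 -> b < 3 -> c < 3 -> a != b -> a != c -> b != c -> i = a :> nat ->
    exists j k : 'I_3, [/\ i != j, i != k & j != k])%N.
  move=> a3 b3 c3 ab ac bc ia; exists (Ordinal b3); exists (Ordinal c3).
  by rewrite -!val_eqE /= ia.
case: i H => -[|[|[|//]]] h H; first exact: (H 0 1 2)%N.
  exact: (H 1 0 2)%N.
exact: (H 2 0 1)%N.
Qed.

Section Chart.
Variables i j k : 'I_3.
Hypotheses (ij : i != j) (ik : i != k) (jk : j != k).

Definition chart (t u : R) : RP := toP (line3 i j t u).

Lemma line3_neq0 (t u : R) : line3 i j t u != 0.
Proof. by apply/eqP => /rowP/(_ i)/eqP; rewrite !mxE eqxx oner_eq0. Qed.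

(** Exchanging [j] and [k] exchanges the chart coordinates, so that results on t also give those on
    u. *)
Lemma line3_swap (t u : R) : line3 i k u t = line3 i j t u.
Proof.
apply: (row3_eq ij ik jk); first by rewrite row3_i.
  by rewrite mxE eq_sym (negPf ij) (negPf jk).
by rewrite mxE eq_sym (negPf ik) eqxx.
Qed.

Lemma line3_t (t u : R) : line3 i j t u = row3 i j 1 0 u + t *: row3 i j 0 1 0.
Proof.
apply/esym/(row3_eq ij ik jk); rewrite mxE rowZ ?row3_i ?row3_j ?row3_k//; ring.
Qed.

Lemma line3_u (t u : R) : line3 i j t u = row3 i j 1 t 0 + u *: row3 i j 0 0 1.
Proof.
apply/esym/(row3_eq ij ik jk); rewrite mxE rowZ ?row3_i ?row3_j ?row3_k//; ring.
Qed.

Lemma chart_component_t (X : set RP) t t' u :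
  (forall s, Num.min t t' <= s <= Num.max t t' -> X (chart s u)) ->
  connected_component X (chart t u) (chart t' u).
Proof.
move=> h; rewrite /chart !line3_t; apply: affine_component => s hs.
by rewrite -line3_t; split; [exact: line3_neq0 | exact: h].
Qed.

Lemma chart_component_u (X : set RP) t u u' :
  (forall s, Num.min u u' <= s <= Num.max u u' -> X (chart t s)) ->
  connected_component X (chart t u) (chart t u').
Proof.
move=> h; rewrite /chart !line3_u; apply: affine_component => s hs.
by rewrite -line3_u; split; [exact: line3_neq0 | exact: h].
Qed.

Lemma chart_near_t (V : set RP) t u : open V -> V (chart t u) ->
  exists2 e, 0 < e & forall s, `|s - t| < e -> V (chart s u).
Proof.
move=> oV Vtu.
have c := @toP_continuous R R (fun s => row3 i j 1 0 u + s *: row3 i j 0 1 0) t.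
rewrite -line3_t in c; have {}c := c (line3_neq0 _ _) (@affine_continuous _ _ _).
have H : \forall s \near t, V (chart s u).
  have Vn : nbhs ((@toP R \o (fun s => row3 i j 1 0 u + s *: row3 i j 0 1 0)) t) V.
    by rewrite /= -line3_t; exact: open_nbhs_nbhs.
  apply: (@filterS _ (nbhs t) _ _ _ _ (c _ Vn)) => s /=.
  by rewrite -line3_t.
have /nbhs_ballP[e /= e0 He] := H.
by exists e => // s st; apply: He; rewrite -ball_normE /= distrC.
Qed.

End Chart.

Variables (d : nat) (f : tpoly R).
Hypotheses (f_form : is_form d f) (f_smooth : smooth_curve f).
Local Notation D := (real_dual_curve f).
Local Notation A := (avoidance_locus f).

(** A square of the affine chart in homogeneous form: squaring makes it independent of the
    representative, and the strict inequalities force coordinate [i] to be nonzero. *)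
Definition square (i j k : 'I_3) (t0 u0 e : R) : set RP := [set x |
  (hcoord x 0 j - t0 * hcoord x 0 i) ^+ 2 < (e * hcoord x 0 i) ^+ 2 /\
  (hcoord x 0 k - u0 * hcoord x 0 i) ^+ 2 < (e * hcoord x 0 i) ^+ 2].

Section Square.
Variables (i j k : 'I_3) (t0 u0 e : R).
Hypotheses (ij : i != j) (ik : i != k) (jk : j != k) (e0 : 0 < e).

Lemma square_toP v : v != 0 -> square i j k t0 u0 e (toP v) <->
  (v 0 j - t0 * v 0 i) ^+ 2 < (e * v 0 i) ^+ 2 /\
  (v 0 k - u0 * v 0 i) ^+ 2 < (e * v 0 i) ^+ 2.
Proof.
move=> v0; have [c c0 vE] := hcoord_toP v0; rewrite /square /= vE !rowZ.
have c2 : 0 < c ^+ 2 by rewrite exprn_even_gt0.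
have E x y z : (c * x - z * (c * y)) ^+ 2 < (e * (c * y)) ^+ 2
    <-> (x - z * y) ^+ 2 < (e * y) ^+ 2.
  have -> : c * x - z * (c * y) = c * (x - z * y) by ring.
  by rewrite [e * (c * y)]mulrCA ![(c * _) ^+ 2]exprMn ltr_pM2l.
by split => -[h1 h2]; split; apply/E.
Qed.

Lemma square_chart t u : square i j k t0 u0 e (chart i j t u) <->
  `|t - t0| < e /\ `|u - u0| < e.
Proof.
have sq x : (x ^+ 2 < e ^+ 2) = (`|x| < e).
  by rewrite -[x ^+ 2]real_normK ?num_real// ltr_pXn2r ?nnegrE// ltW.
apply: (iff_trans (square_toP (line3_neq0 _ _ _ _))).
by rewrite /line3 row3_i row3_j// row3_k// !mulr1 !sq.
Qed.

Lemma square_onto x : square i j k t0 u0 e x -> exists t u, x = chart i j t u.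
Proof.
move=> [h _]; have hi : hcoord x 0 i != 0.
  apply: contraTneq h => ->; rewrite !mulr0 subr0 expr0n /= -leNgt; exact: sqr_ge0.
exists (hcoord x 0 j / hcoord x 0 i), (hcoord x 0 k / hcoord x 0 i).
rewrite -[LHS]toP_hcoord /chart.
rewrite -(toPZ (line3_neq0 _ _ _ _) hi); congr toP.
by apply/rowP => m; rewrite rowZ /line3; have [->|->|->] := ord3_cases ij ik jk m;
  rewrite ?row3_i ?row3_j ?row3_k ?mulr1// mulrC divfK.
Qed.

Lemma square_open : open (square i j k t0 u0 e).
Proof.
apply: open_toP => v v0 /(square_toP v0)[h1 h2].
have cc m : continuous (fun w : 'rV[R]_3 => w 0 m) by move=> w; exact: coord_continuous.
have c m z : continuous (fun w : 'rV[R]_3 =>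
    (e * w 0 i) ^+ 2 - (w 0 m - z * w 0 i) ^+ 2).
  by apply: ctsB; apply: cts_sqr; [|apply: ctsB => //];
    apply: ctsM => //; exact: ctsC.
have N m z : (v 0 m - z * v 0 i) ^+ 2 < (e * v 0 i) ^+ 2 ->
    \forall w \near v, ((w : 'rV[R]_3) 0 m - z * w 0 i) ^+ 2 < (e * w 0 i) ^+ 2.
  rewrite -subr_gt0 => h; have H := c m z v _ (lt_nbhsr h).
  by apply: (@filterS _ (nbhs v) _ _ _ _ H) => w /=; rewrite subr_gt0.
have : \forall w \near v, ((w : 'rV[R]_3) 0 j - t0 * w 0 i) ^+ 2 < (e * w 0 i) ^+ 2 /\
    ((w : 'rV[R]_3) 0 k - u0 * w 0 i) ^+ 2 < (e * w 0 i) ^+ 2.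
  exact: filterI (N _ _ h1) (N _ _ h2).
by apply: filterS2 (near_neq0 v0) => w w0 /(square_toP w0).
Qed.

Hypotheses
  (gap_t : forall a b, t0 - e < a -> a < b -> b < t0 + e ->
    exists2 t, a < t < b & forall u, `|u - u0| < e -> (~` D) (chart i j t u))
  (gap_u : forall a b, u0 - e < a -> a < b -> b < u0 + e ->
    exists2 u, a < u < b & forall t, `|t - t0| < e -> (~` D) (chart i j t u)).

Lemma gap_t_near t r : `|t - t0| < e -> 0 < r -> exists t',
  [/\ `|t' - t| < r, `|t' - t0| < e &
      forall u, `|u - u0| < e -> (~` D) (chart i j t' u)].
Proof.
rewrite ltr_norml => /andP[h1 h2] r0.
(* The right end is the midpoint between [t] and the nearer of the two limits, hence strictly inside
   both. *)
have [|||t' /andP[a b] H] := @gap_t t ((t + Num.min (t + r) (t0 + e)) / 2).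
- lra.
- have : t < Num.min (t + r) (t0 + e) by rewrite lt_min; apply/andP; split; lra.
  by set q := Num.min _ _; lra.
- have : Num.min (t + r) (t0 + e) <= t0 + e by rewrite ge_min lexx orbT.
  by set q := Num.min _ _; lra.
have q1 : Num.min (t + r) (t0 + e) <= t + r by rewrite ge_min lexx.
have q2 : Num.min (t + r) (t0 + e) <= t0 + e by rewrite ge_min lexx orbT.
move: q1 q2 b; set q := Num.min _ _ => q1 q2 b.
by exists t'; split => //; rewrite ltr_norml; apply/andP; split; lra.
Qed.

Lemma gap_u_near u r : `|u - u0| < e -> 0 < r -> exists u',
  [/\ `|u' - u| < r, `|u' - u0| < e &
      forall t, `|t - t0| < e -> (~` D) (chart i j t u')].
Proof.
rewrite ltr_norml => /andP[h1 h2] r0.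
have [|||t' /andP[a b] H] := @gap_u u ((u + Num.min (u + r) (u0 + e)) / 2).
- lra.
- have : u < Num.min (u + r) (u0 + e) by rewrite lt_min; apply/andP; split; lra.
  by set q := Num.min _ _; lra.
- have : Num.min (u + r) (u0 + e) <= u0 + e by rewrite ge_min lexx orbT.
  by set q := Num.min _ _; lra.
have q1 : Num.min (u + r) (u0 + e) <= u + r by rewrite ge_min lexx.
have q2 : Num.min (u + r) (u0 + e) <= u0 + e by rewrite ge_min lexx orbT.
move: q1 q2 b; set q := Num.min _ _ => q1 q2 b.
by exists t'; split => //; rewrite ltr_norml; apply/andP; split; lra.
Qed.

Lemma between_near (x y z r s : R) : `|x - z| < r -> `|y - z| < r ->
  Num.min x y <= s <= Num.max x y -> `|s - z| < r.
Proof.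
rewrite !ltr_norml ge_min le_max => /andP[a b] /andP[a' b'] /andP[/orP[] ? /orP[] ?];
  by apply/andP; split; lra.
Qed.

Lemma square_dense x : square i j k t0 u0 e x -> closure (square i j k t0 u0 e `\` D) x.
Proof.
move=> sx B; rewrite nbhsE => -[V [Vo Vx] VB].
have [t [u xE]] := square_onto sx; rewrite {}xE in sx Vx *.
have [t1 u1] := (square_chart t u).1 sx.
have [r r0 Hr] := chart_near_t ij ik jk Vo Vx.
have [t' [tr te Dt]] := gap_t_near t1 r0.
exists (chart i j t' u); split; last by apply: VB; exact: Hr.
by split; [apply/square_chart | exact: Dt].
Qed.

(** The path has four segments: from [x] to a nearby tangent-free line t = t2, along it to a
    tangent-free line u = u2, along that to t = t', and finally to [y]. The outer segments are short
    enough to stay in the open complement of the dual curve. *)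
Lemma square_component x y : square i j k t0 u0 e x -> square i j k t0 u0 e y ->
  ~ D x -> ~ D y -> connected_component (~` D) x y.
Proof.
move=> sx sy; have [t [u xE]] := square_onto sx; have [t' [u' yE]] := square_onto sy.
rewrite {}xE {}yE in sx sy *.
have [t1 u1] := (square_chart t u).1 sx; have [t'1 u'1] := (square_chart t' u').1 sy.
move=> Dx Dy; have oD := dual_closed f_form f_smooth.
have [r r0 Hr] := chart_near_t ij ik jk oD Dx.
have kj : k != j by rewrite eq_sym.
have sw (s v : R) : chart i k v s = chart i j s v by rewrite /chart (line3_swap ij ik jk).
have [r' r'0 Hr'] : exists2 r', 0 < r' & forall s, `|s - u'| < r' -> (~` D) (chart i j t' s).
  have Dy' : (~` D) (chart i k u' t') by rewrite sw.
  have [r' r'0 H] := chart_near_t ik ij kj oD Dy'.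
  by exists r' => // s /H; rewrite sw.
have [t2 [t2r t2e D2]] := gap_t_near t1 r0.
have [u2 [u2r u2e D3]] := gap_u_near u'1 r'0.
apply: (@connected_component_trans _ _ (chart i j t2 u)).
  apply: (chart_component_t ij ik jk) => s hs; apply: Hr.
  by apply: between_near hs => //; rewrite subrr normr0.
apply: (@connected_component_trans _ _ (chart i j t2 u2)).
  apply: (chart_component_u ij ik jk) => s hs; apply: D2; exact: between_near hs.
apply: (@connected_component_trans _ _ (chart i j t' u2)).
  apply: (chart_component_t ij ik jk) => s hs; apply: D3; exact: between_near hs.
apply: (chart_component_u ij ik jk) => s hs; apply: Hr'.
by apply: between_near hs => //; rewrite subrr normr0.
Qed.

End Square.

Lemma local_connectivity l : A l -> exists N, [/\ open N, N l,
  forall x y, N x -> N y -> ~ D x -> ~ D y -> connected_component (~` D) x y &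
  forall x, N x -> closure (N `\` D) x].
Proof.
rewrite -(toP_hcoord l); move: (hcoord l) (hcoord_neq0 l) => v v0 Al.
have /existsP[i vi] : [exists i, v 0 i != 0].
  apply: contraNT v0; rewrite negb_exists => /forallP h.
  by apply/eqP/rowP => m; rewrite mxE; apply/eqP; have := h m; rewrite negbK.
have [j [k [ij ik jk]]] := other_indices i.
have kj : k != j by rewrite eq_sym.
pose t0 := v 0 j / v 0 i; pose u0 := v 0 k / v 0 i.
have vE : v = v 0 i *: line3 i j t0 u0.
  by apply/rowP => m; rewrite rowZ /line3; have [->|->|->] := ord3_cases ij ik jk m;
    rewrite ?row3_i ?row3_j ?row3_k ?mulr1// mulrC divfK.
have lE : toP v = chart i j t0 u0 by rewrite vE toPZ// line3_neq0.
have av : avoidv f (line3 i j t0 u0).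
  by apply/(avoidance_toP f_form (line3_neq0 _ _ _ _)); rewrite -/(chart _ _ _ _) -lE.
(* The exchanged chart turns [dual_gap] into a statement on the values of u. *)
have av' : avoidv f (line3 i k u0 t0) by rewrite (line3_swap ij ik jk).
have [e1 e10 H1] := dual_gap ij ik jk f_form f_smooth av.
have [e2 e20 H2] := dual_gap ik ij kj f_form f_smooth av'.
pose e := Num.min e1 e2.
have e0 : 0 < e by rewrite lt_min e10.
have ee1 : e <= e1 by rewrite ge_min lexx.
have ee2 : e <= e2 by rewrite ge_min lexx orbT.
have gt a b : t0 - e < a -> a < b -> b < t0 + e ->
    exists2 t, a < t < b & forall u, `|u - u0| < e -> (~` D) (chart i j t u).
  move=> h1 h2 h3; have [|//||t tab Ht] := H1 a b; [lra|lra|].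
  exists t => // u ue /(dual_toP f (line3_neq0 _ _ _ _)).
  by apply: Ht; exact: lt_le_trans ee1.
have gu a b : u0 - e < a -> a < b -> b < u0 + e ->
    exists2 u, a < u < b & forall t, `|t - t0| < e -> (~` D) (chart i j t u).
  move=> h1 h2 h3; have [|//||u uab Hu] := H2 a b; [lra|lra|].
  exists u => // t te /(dual_toP f (line3_neq0 _ _ _ _)).
  rewrite -(line3_swap ij ik jk).
  by apply: Hu; exact: lt_le_trans ee2.
exists (square i j k t0 u0 e); split.
- exact: square_open.
- by rewrite lE; apply/square_chart => //; rewrite !subrr !normr0.
- by move=> x y; exact: square_component.
- by move=> x; exact: square_dense.
Qed.

End Segments.

(** * Cones *)

Lemma mix_neq0 (R : realFieldType) (p q t : R) :
  0 <= t <= 1 -> 0 < p * q -> (1 - t) * p + t * q != 0.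
Proof.
move=> /andP[t0 t1] pq; apply/eqP => e.
have p0 : p != 0 by apply: contraTneq pq => ->; rewrite mul0r ltxx.
have p2 : 0 < p ^+ 2 by rewrite exprn_even_gt0.
have E : (1 - t) * p ^+ 2 + t * (p * q) = 0.
  have -> : (1 - t) * p ^+ 2 + t * (p * q) = ((1 - t) * p + t * q) * p by ring.
  by rewrite e mul0r.
have [tz|tn0] := eqVneq t 0.
  by move: E p2; rewrite tz subr0 mul1r mul0r addr0 => ->; rewrite ltxx.
have : 0 < t * (p * q) by rewrite mulr_gt0// lt_neqAle eq_sym tn0.
have : 0 <= (1 - t) * p ^+ 2 by rewrite mulr_ge0 ?subr_ge0// ltW.
by move: E; set a := _ * _ ^+ 2; set b := t * _; lra.
Qed.

Section Cones.
Variables (R : realType) (d : nat) (f : tpoly R).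
Hypotheses (d_even : ~~ odd d) (f_form : is_form d f) (f_smooth : smooth_curve f).
Local Notation RP := (RP2 R).
Local Notation D := (real_dual_curve f).
Local Notation A := (avoidance_locus f).

(** Off the dual curve, a neighbourhood from [local_connectivity] lies in a single component, and by
    density all of it lies in the closure. *)
Lemma closure_component_nbhs x l : closure (connected_component (~` D) x) l -> A l ->
  nbhs l (closure (connected_component (~` D) x)).
Proof.
move=> cl Al; have [N [oN Nl NC Nd]] := local_connectivity f_form f_smooth Al.
have [a [xa Na]] := cl N (open_nbhs_nbhs (conj oN Nl)).
have Da : ~ D a := connected_component_sub xa.
have ND : N `\` D `<=` connected_component (~` D) x.
  move=> b [Nb Db]; apply: connected_component_trans xa _; exact: NC.
have NU : N `<=` closure (connected_component (~` D) x).
  by move=> b /Nd; apply: closure_subset.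
exact: filterS NU (open_nbhs_nbhs (conj oN Nl)).
Qed.

(** Inside the avoidance locus the closure of a component is open as well as closed. *)
Lemma connected_closure_component x (S : set RP) s :
  connected S -> S `<=` A -> S s -> closure (connected_component (~` D) x) s ->
  S `<=` closure (connected_component (~` D) x).
Proof.
move=> cS SA Ss cs; set U := closure _.
suff <- : S `&` U = S by exact: subIsetr.
apply: cS.
- by exists s.
- exists (interior U); first exact: open_interior.
  apply/seteqP; split => y [Sy Uy]; split => //.
    by apply: closure_component_nbhs => //; exact: SA.
  exact: interior_subset.
- by exists U => //; exact: closed_closure.
Qed.

(** Each real point of the curve gives a plane in the space of lines; the product makes the
    condition independent of the representative [x]. *)
Definition same_side (v w : 'rV[R]_3) : Prop :=
  forall x, x != 0 -> evalf f x = 0 -> 0 < dot v x * dot w x.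

Variable x0 : RP.
Local Notation F := (filled_component f (connected_component (~` D) x0)).

Lemma punctured_coneP v : punctured_cone F v <-> v != 0 /\ F (toP v).
Proof.
split=> [[w Fw <-]|[v0 Fv]]; first by rewrite toP_val; split; [exact: val_neq0 |].
by have [w wv] := val_nzvec v0; exists w => //=; rewrite -toP_val wv.
Qed.

Lemma dotBZ (v w : 'rV[R]_3) t x : dot (v + t *: (w - v)) x = (1 - t) * dot v x + t * dot w x.
Proof. by rewrite dotC dotDr dotZr dotDr -scaleN1r dotZr !(dotC x); ring. Qed.

(** No point of the segment meets the plane of a real point, so the segment consists of avoiding
    lines; being connected, its image stays in the closure of the component. *)
Lemma segment_component v w : punctured_cone F v -> same_side v w ->
  (forall t, 0 <= t <= 1 -> v + t *: (w - v) != 0) ->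
  connected_component (punctured_cone F) v w.
Proof.
move=> Fv vw nz; have [v0 [clv Av]] := (punctured_coneP v).1 Fv.
pose g t := v + t *: (w - v).
have cg : connected (g @` `[0, 1]).
  apply: connected_continuous_connected; first exact: segment_connected.
  by apply: continuous_subspaceT; exact: affine_continuous.
have g0 : g 0 = v by rewrite /g scale0r addr0.
have g1 : g 1 = w by rewrite /g scale1r addrC subrK.
have Ag t : 0 <= t <= 1 -> A (toP (g t)).
  move=> t01; apply/(avoidance_toP f_form (nz t t01)) => x nx0 gx.
  apply/eqP => fx; have := mix_neq0 t01 (vw x nx0 fx).
  by rewrite -dotBZ -/(g t) gx eqxx.
have clg : (@toP R \o g) @` `[0, 1] `<=` closure (connected_component (~` D) x0).
  apply: (@connected_closure_component x0 _ (toP v)) => //.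
  - apply: connected_continuous_connected; first exact: segment_connected.
    apply: continuous_in_subspaceT => t; rewrite inE /= in_itv /= => /nz gt0.
    by apply: (@toP_continuous R R g) => //; exact: affine_continuous.
  - by move=> y [t /=]; rewrite in_itv /= => t01 <-; exact: Ag.
  - by exists 0; rewrite /= ?g0// in_itv /= lexx ler01.
apply: (@connected_component_max _ _ (g @` `[0, 1])) => //.
- by exists 0; rewrite ?g0//= in_itv /= lexx ler01.
- move=> y [t /= t01 <-]; apply/punctured_coneP.
  have t01' : 0 <= t <= 1 by move: t01; rewrite in_itv.
  by split; [exact: nz | split; [apply: clg; exists t | exact: Ag]].
- by exists 1; rewrite ?g1//= in_itv /= lexx ler01.
Qed.

(** The product with a real point of the curve has no zero on a connected part of the cone, so its
    values form an interval that misses 0. *)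
Lemma component_same_side v y : connected_component (punctured_cone F) v y ->
  y != 0 /\ same_side v y.
Proof.
move=> [C [Cv CF cC] Cy]; have [y0 _] := (punctured_coneP y).1 (CF _ Cy); split => //.
move=> x nx0 fx.
have nz w : C w -> dot w x != 0.
  move=> /CF/punctured_coneP[w0 [_ /(avoidance_toP f_form w0) aw]].
  by apply/eqP => wx; have := aw x nx0 wx; rewrite fx eqxx.
have cx : continuous (fun w : 'rV[R]_3 => dot w x).
  apply: cts_sum => i; apply: ctsM; last exact: ctsC.
  by move=> l; exact: coord_continuous.
have /connected_intervalP I : connected ((fun w => dot w x) @` C).
  by apply: connected_continuous_connected => //; exact: continuous_subspaceT.
have iv : ((fun w => dot w x) @` C) (dot v x) by exists v.
have iy : ((fun w => dot w x) @` C) (dot y x) by exists y.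
have no0 : ~ ((fun w => dot w x) @` C) 0 by move=> [w /nz/eqP].
have := nz _ Cv; have := nz _ Cy.
case: (ltgtP (dot v x) 0) => // hv; case: (ltgtP (dot y x) 0) => // hy _ _.
- by rewrite nmulr_rgt0.
- by exfalso; apply: no0; apply: (I _ _ iv iy); rewrite !ltW.
- by exfalso; apply: no0; apply: (I _ _ iy iv); rewrite !ltW.
- by rewrite mulr_gt0.
Qed.

Lemma same_side_component v w : punctured_cone F v -> w != 0 -> same_side v w ->
  connected_component (punctured_cone F) v w.
Proof.
move=> Fv w0 vw; have [v0 _] := (punctured_coneP v).1 Fv.
have [nz|] := pselect (forall t, 0 <= t <= 1 -> v + t *: (w - v) != 0).
  exact: segment_component.
move=> /existsNP[t /not_implyP[t01 /negP]]; rewrite negbK => /eqP vt0.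
(* [w] is opposite to [v], so the curve has no real point *)
have nozero x : x != 0 -> evalf f x != 0.
  move=> nx0; apply/eqP => fx; have := vw x nx0 fx.
  move=> /(mix_neq0 t01); rewrite -dotBZ vt0 dotC -(scale0r x) dotZr mul0r.
  by rewrite eqxx.
have side y z : same_side y z by move=> x /nozero/eqP.
have /existsP[i vi] : [exists i, v 0 i != 0].
  apply: contraNT v0; rewrite negb_exists => /forallP h.
  by apply/eqP/rowP => m; rewrite mxE; apply/eqP; have := h m; rewrite negbK.
have t0 : t != 0.
  by apply: contraNneq v0 => tz; move: vt0; rewrite tz scale0r addr0 => ->.
have wi : w 0 i != 0.
  have /rowP/(_ i) := vt0; rewrite !mxE => e.
  apply: contraNneq v0 => wi; rewrite wi sub0r in e.
  have {}e : (1 - t) * v 0 i = 0 by rewrite -e; ring.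
  move/eqP: e; rewrite mulf_eq0 (negPf vi) orbF subr_eq0 => /eqP t1.
  by move: vt0; rewrite -t1 scale1r addrC subrK => we; rewrite we eqxx in w0.
have [j [k [ij ik jk]]] := other_indices i.
(* A detour around the apex: [m] vanishes at coordinate [i], where [v] and [w] do not, so neither
   segment ending at [m] passes through 0. *)
pose m : 'rV[R]_3 := row3 i j 0 1 0.
have mi : m 0 i = 0 by rewrite /m row3_i.
have mj : m 0 j = 1 by rewrite /m row3_j.
have m0 : m != 0 by apply/eqP => /rowP/(_ j)/eqP; rewrite mj mxE oner_eq0.
have entry (y z : 'rV[R]_3) s l : y + s *: (z - y) = 0 -> y 0 l + s * (z 0 l - y 0 l) = 0.
  by move=> /rowP/(_ l); rewrite !mxE.
have vm : connected_component (punctured_cone F) v m.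
  apply: segment_component => // s _; apply/eqP => e.
  have := entry _ _ _ i e; rewrite mi => ei.
  have /eqP : (1 - s) * v 0 i = 0 by rewrite -ei; ring.
  rewrite mulf_eq0 (negPf vi) orbF subr_eq0 => /eqP s1.
  have := entry _ _ _ j e; rewrite -s1 mul1r mj addrC subrK => /eqP.
  by rewrite oner_eq0.
have Fm := connected_component_sub vm.
apply: connected_component_trans vm _; apply: segment_component => //.
move=> s _; apply/eqP => e.
have := entry _ _ _ i e; rewrite mi subr0 add0r => /eqP.
rewrite mulf_eq0 (negPf wi) orbF => /eqP s0.
have := entry _ _ _ j e; rewrite s0 mul0r addr0 mj => /eqP.
by rewrite oner_eq0.
Qed.

(** The component of [v] is cut out by inequalities linear in the second vector of [same_side],
    which survive convex combinations; a combination equal to 0 is the apex. *)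
Lemma filled_component_convex : convex_as_cone F.
Proof.
move=> K [v Fv <-] x y p; rewrite !inE => xK yK.
pose a : R := p%:num; pose z : 'rV[R]_3 := a *: x + (1 - a) *: y.
suff : (0 |` connected_component (punctured_cone F) v) z by [].
have a01 : 0 <= a <= 1 by rewrite /a; apply/andP; split.
have [->|z0] := eqVneq z 0; [by left | right].
apply: same_side_component => // q q0 fq.
have side (u : 'rV[R]_3) : (0 |` connected_component (punctured_cone F) v) u ->
    u = 0 \/ 0 < dot v q * dot u q.
  by move=> [->|/component_same_side[_ h]]; [left | right; exact: h].
have dz : dot v q * dot z q = a * (dot v q * dot x q) + (1 - a) * (dot v q * dot y q).
  by rewrite /z dotC [dot _ q]dotC dotDr !dotZr !(dotC q); ring.
have dot0 : dot (0 : 'rV[R]_3) q = 0 by rewrite dotC -(scale0r q) dotZr mul0r.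
rewrite dz; move: a01 z0 => /andP[a0 a1]; rewrite /z.
have a1' : 0 <= 1 - a by rewrite subr_ge0.
move: xK yK => /side[->|hx] /side[->|hy].
- by rewrite !scaler0 addr0 eqxx.
- rewrite scaler0 add0r dot0 !mulr0 add0r scaler_eq0 negb_or => /andP[h _].
  by rewrite mulr_gt0// lt_neqAle eq_sym h.
- rewrite scaler0 addr0 dot0 !mulr0 addr0 scaler_eq0 negb_or => /andP[h _].
  by rewrite mulr_gt0// lt_neqAle eq_sym h.
- move=> _; have [->|an0] := eqVneq a 0; first by rewrite mul0r add0r subr0 mul1r.
  apply: ltr_pwDl; first by rewrite mulr_gt0// lt_neqAle eq_sym an0.
  by rewrite mulr_ge0// ltW.
Qed.

End Cones.

(** * Decomposition of the avoidance locus into convex pieces *)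

Theorem proposition5p1 (R : realType) (d : nat) (f : tpoly R)
    (d_gt0 : (0 < d)%N) (d_even : ~~ odd d)
    (f_form : is_form d f) (f_smooth : smooth_curve f) :
  exists comps : set (set (RP2 R)),
    [/\ comps `<=` components (~` real_dual_curve f),
        avoidance_locus f `\` real_dual_curve f = \bigcup_(U in comps) U,
        closure (avoidance_locus f) = closure (\bigcup_(U in comps) U) &
        forall U, comps U -> convex_as_cone (filled_component f U)].
Proof.
pose comps : set (set (RP2 R)) := [set connected_component (~` real_dual_curve f) x
  | x in avoidance_locus f `\` real_dual_curve f].
have cover : avoidance_locus f `\` real_dual_curve f = \bigcup_(U in comps) U.
  apply/seteqP; split => [x xAD|x [U [y [Ay Dy] <-] yx]].
    exists (connected_component (~` real_dual_curve f) x); first by exists x.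
    by apply: connected_component_refl; case: xAD.
  split; last exact: connected_component_sub yx.
  apply: (connected_avoidance f_form f_smooth d_even _ _ _ Ay yx).
  - exact: component_connected.
  - exact: connected_component_sub.
  - exact: connected_component_refl.
exists comps; split => //.
- by move=> U [x [Ax Dx] <-]; exists x.
(* Avoiding lines off the dual curve are dense in the locus: the density in [local_connectivity] is
   applied to the open set of avoiding lines in [V]. *)
- rewrite -cover; apply/seteqP; split => [l cl B|]; last first.
    by apply: closure_subset; exact: subDsetl.
  rewrite nbhsE => -[V [Vo Vl] VB].
  have [a [Aa Va]] := cl V (open_nbhs_nbhs (conj Vo Vl)).
  have [N [oN Na _ Nd]] := local_connectivity f_form f_smooth Aa.
  have oAV : open (avoidance_locus f `&` V).
    exact: openI (avoidance_open f_form) Vo.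
  have [b [[_ Db] [Ab Vb]]] := Nd a Na _ (open_nbhs_nbhs (conj oAV (conj Aa Va))).
  by exists b; split => //; exact: VB.
- by move=> U [x _ <-]; exact: (filled_component_convex f_form f_smooth).
Qed.
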